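(* If $\tilde w\in\mathbb{O}_{1,\delta}$ and $\ell(\tilde w)=2k+1$ with $k\in\mathbb{N}$, then $$f_{\tilde w,\mathbb{O}}=\begin{cases}v-v^{-1},&\mathbb{O}=\mathbb{O}_{2j,\delta}\ (1\leq j\leq k),\\ 1,&\mathbb{O}=\mathbb{O}_{1,\delta},\\ 0,&\text{otherwise.}\end{cases}$$
   Context: $W=\langle s_1,s_2\rangle$ is the finite Weyl group of type $A_2$; $\alpha_1,\alpha_2$ are the simple roots, identified with the simple coroots ($\langle\alpha_i,\alpha_i\rangle=2$, $\langle\alpha_1,\alpha_2\rangle=-1$); $Q=\mathbb{Z}\alpha_1\oplus\mathbb{Z}\alpha_2$; $P$ is the coweight lattice; $\widetilde W=P\rtimes W$ with translations $t^\lambda$. $W_a=Q\rtimes W$ is the Coxeter group generated by $s_0=t^{\alpha_1+\alpha_2}s_1s_2s_1$, $s_1$, $s_2$; $\widetilde W=W_a\rtimes\langle\tau\rangle$ with $\tau^3=1$, $\tau s_0\tau^{-1}=s_1$, $\tau s_1\tau^{-1}=s_2$, $\tau s_2\tau^{-1}=s_0$; $\ell(w\tau^j)=\ell(w)$ for $w\in W_a$. $\delta$ is the automorphism of $\widetilde W$ fixing $s_0$ and interchanging $s_1$ and $s_2$ (so $\delta(\tau)=\tau^{-1}$). $\tilde w,\tilde w'$ are $\delta$-conjugate if $\tilde w'=\tilde x\tilde w\delta(\tilde x)^{-1}$ for some $\tilde x\in\widetilde W$. $\mathbb{N}$ contains $0$. Class polynomials: $\widetilde H$ is the algebra over $\mathbb{Z}[v,v^{-1}]$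 with basis $T_{\tilde w}$ ($\tilde w\in\widetilde W$), $T_{\tilde x}T_{\tilde y}=T_{\tilde x\tilde y}$ if $\ell(\tilde x)+\ell(\tilde y)=\ell(\tilde x\tilde y)$, and $(T_s-v)(T_s+v^{-1})=0$ for $s\in\{s_0,s_1,s_2\}$; $\delta$ acts on $\widetilde H$ by $T_{\tilde w}\mapsto T_{\delta(\tilde w)}$. $[\widetilde H,\widetilde H]_\delta$ is the submodule spanned by all $hh'-h'\delta(h)$. For a $\delta$-conjugacy class $\mathbb{O}$, $T_{\mathbb{O}}$ is the image in $\widetilde H/[\widetilde H,\widetilde H]_\delta$ of $T_w$ for any minimal length $w\in\mathbb{O}$; by He–Nie this is well defined and the $T_{\mathbb{O}}$ form a basis. The class polynomials $f_{\tilde w,\mathbb{O}}$ are the unique coefficients with $T_{\tilde w}\equiv\sum_{\mathbb{O}}f_{\tilde w,\mathbb{O}}T_{\mathbb{O}}\bmod[\widetilde H,\widetilde H]_\delta$. For $X\subset W_a$ put $\widehat X=X\sqcup\{(\tau x\tau^{-1})\tau^2\mid x\in X\}\sqcup\{(\tau^2x\tau^{-2})\tau\mid x\in X\}$. $\delta$-conjugacy classes: $\mathbb{O}_{1,\delta}=\widehat X$ for $X=\{t^\lambda s_1,\ t^\lambda s_2\mid\lambda\in Q\}$; for a positive integer $m$, with $\epsilon(m)=1$ if $m$ is odd and $0$ if $m$ is even, $\mathbb{O}_{2m,\delta}=\widehat X_m$, where $X_m$ consists of the elements, for all $k\in\mathbb{Z}$, $t^{(k-\lfloor m/2\rfloor)\alpha_1+(2k+\epsilon(m))\alpha_2}s_2s_1$,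 $t^{(k+\lfloor (m+1)/2\rfloor)\alpha_1+(2k+\epsilon(m))\alpha_2}s_2s_1$, $t^{(2k+\epsilon(m))\alpha_1+(k+\lfloor (m+1)/2\rfloor)\alpha_2}s_1s_2$, $t^{(2k+\epsilon(m))\alpha_1+(k-\lfloor m/2\rfloor)\alpha_2}s_1s_2$, $t^{k\alpha_1+(m-k)\alpha_2}$, $t^{(k-m)\alpha_1-k\alpha_2}$. *)

(* Defs.v *)
From HB Require Import structures.
From mathcomp Require Import all_boot all_order all_fingroup all_algebra.
From mathcomp Require Import zify ring.
From mathcomp Require Import boolp classical_sets functions cardinality fsbigop.

Set Implicit Arguments.
Unset Strict Implicit.
Unset Printing Implicit Defensive.

Import Order.TTheory GRing.Theory Num.Theory.

Local Open Scope classical_set_scope.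
Local Open Scope ring_scope.

(* A coweight lambda is given by the pair (<lambda, alpha_1>, <lambda, alpha_2>),
   i.e. by its coordinates in the basis of fundamental coweights. *)
Definition coweight : zmodType := (int * int)%type.

Definition alpha1 : coweight := (2, -1).
Definition alpha2 : coweight := (-1, 2).

Definition root_lattice : set coweight :=
  [set x | exists m n : int, x = alpha1 *~ m + alpha2 *~ n].

(* W is 'S_3, acting on P = Z^3 / Z(1,1,1) by permutation of the coordinates;
   [coord3 x] is the representative of x whose last coordinate is 0, and
   alpha_i pairs with it as the difference of the coordinates i and i+1.
   As the product s * u in 'S_3 is "s, then u", x |-> x \o w is a left action. *)
Definition i0 : 'I_3 := @Ordinal 3 0 isT.
Definition i1 : 'I_3 := @Ordinal 3 1 isT.
Definition i2 : 'I_3 := @Ordinal 3 2 isT.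

Definition coord3 (x : coweight) (i : 'I_3) : int :=
  if i == i0 then x.1 + x.2 else if i == i1 then x.2 else 0.

Definition act (w : 'S_3) (x : coweight) : coweight :=
  (coord3 x (w i0) - coord3 x (w i1), coord3 x (w i1) - coord3 x (w i2)).
Arguments act : simpl never.

Definition r1 : 'S_3 := tperm i0 i1.
Definition r2 : 'S_3 := tperm i1 i2.

(* [Ext x w] is t^x w. *)
Record ext_weyl := Ext { trans_part : coweight; fin_part : 'S_3 }.

Definition ext_pair (x : ext_weyl) := (trans_part x, fin_part x).
Definition pair_ext (p : coweight * 'S_3) := Ext p.1 p.2.
Lemma ext_pairK : cancel ext_pair pair_ext. Proof. by case. Qed.
HB.instance Definition _ := Choice.copy ext_weyl (can_type ext_pairK).

Lemma I3_cases (P : 'I_3 -> Prop) : P i0 -> P i1 -> P i2 -> forall i, P i.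
Proof.
move=> P0 P1 P2 [[|[|[|//]]] lti].
- by rewrite (_ : Ordinal lti = i0) //; apply: val_inj.
- by rewrite (_ : Ordinal lti = i1) //; apply: val_inj.
- by rewrite (_ : Ordinal lti = i2) //; apply: val_inj.
Qed.

Lemma i_neq : ((i0 == i1) = false) * ((i0 == i2) = false) * ((i1 == i0) = false)
  * ((i1 == i2) = false) * ((i2 == i0) = false) * ((i2 == i1) = false).
Proof. by []. Qed.

Lemma coord3_act w x i :
  coord3 (act w x) i = coord3 x (w i) - coord3 x (w i2).
Proof.
rewrite /act; elim/I3_cases: i; rewrite {1}/coord3 !i_neq ?eqxx /=.
- by rewrite addrA subrK.
- by [].
- by rewrite subrr.
Qed.

Lemma act1 x : act 1%g x = x.
Proof.
by rewrite /act !perm1 /coord3 !i_neq !eqxx /= addrK subr0; case: x.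
Qed.

Lemma actM w u x : act (w * u)%g x = act w (act u x).
Proof.
by rewrite {2}/act !coord3_act /act !permM; congr pair;
  rewrite opprB addrA subrK.
Qed.

Lemma coord3D x y i : coord3 (x + y) i = coord3 x i + coord3 y i.
Proof.
elim/I3_cases: i; rewrite /coord3 !i_neq ?eqxx //=.
by rewrite addrACA.
Qed.

Lemma actD w x y : act w (x + y) = act w x + act w y.
Proof. by rewrite /act !coord3D; congr pair; rewrite opprD addrACA. Qed.

Lemma act0 w : act w 0 = 0.
Proof. by apply: (addrI (act w 0)); rewrite -actD !addr0. Qed.

Definition ext_one := Ext 0 1%g.
Definition ext_mul x y :=
  Ext (trans_part x + act (fin_part x) (trans_part y)) (fin_part x * fin_part y)%g.
Definition ext_inv x :=
  Ext (- act (fin_part x)^-1%g (trans_part x)) (fin_part x)^-1%g.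

Lemma actN w x : act w (- x) = - act w x.
Proof. by apply: (addrI (act w x)); rewrite -actD !subrr act0. Qed.

Lemma ext_mulA : associative ext_mul.
Proof.
by case=> x w [y u] [z t]; rewrite /ext_mul /= actD actM addrA mulgA.
Qed.
Lemma ext_mul1 : left_id ext_one ext_mul.
Proof. by case=> x w; rewrite /ext_mul /= act1 add0r mul1g. Qed.
Lemma ext_1mul : right_id ext_one ext_mul.
Proof. by case=> x w; rewrite /ext_mul /= act0 addr0 mulg1. Qed.
Lemma ext_mulV : left_inverse ext_one ext_inv ext_mul.
Proof. by case=> x w; rewrite /ext_mul /= addNr mulVg. Qed.
Lemma ext_Vmul : right_inverse ext_one ext_inv ext_mul.
Proof. by case=> x w; rewrite /ext_mul /= actN -actM mulgV act1 subrr. Qed.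

HB.instance Definition _ :=
  isGroup.Build ext_weyl ext_mulA ext_mul1 ext_1mul ext_mulV ext_Vmul.

Definition t (x : coweight) : ext_weyl := Ext x 1%g.
Definition s1 : ext_weyl := Ext 0 r1.
Definition s2 : ext_weyl := Ext 0 r2.
Definition s0 : ext_weyl := (t (alpha1 + alpha2) * s1 * s2 * s1)%g.

Definition omega1 : coweight := (1, 0).
Definition omega2 : coweight := (0, 1).
Definition tau : ext_weyl := (t omega1 * s1 * s2)%g.

(* On P, delta exchanges alpha_1 and alpha_2; on W = 'S_3 it is conjugation by
   the longest element. *)
Definition delta (x : ext_weyl) : ext_weyl :=
  Ext ((trans_part x).2, (trans_part x).1) (fin_part x ^ tperm i0 i2)%g.

Lemma ext_mulE x w y u : (Ext x w * Ext y u)%g = Ext (x + act w y) (w * u)%g.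
Proof. by []. Qed.

Lemma tperm_val : (r1 i0 = i1) * (r1 i1 = i0) * (r1 i2 = i2) *
  ((r2 i0 = i0) * (r2 i1 = i2) * (r2 i2 = i1)) *
  ((tperm i0 i2 i0 = i2) * (tperm i0 i2 i1 = i1) * (tperm i0 i2 i2 = i0)).
Proof.
rewrite /r1 /r2 !tpermL !tpermR.
by do !split; rewrite tpermD // i_neq.
Qed.

Lemma coord3E x :
  (coord3 x i0 = x.1 + x.2) * (coord3 x i1 = x.2) * (coord3 x i2 = 0).
Proof. by rewrite /coord3 !i_neq !eqxx. Qed.

Lemma coweight_mulz (a b m : int) :
  ((a, b) : coweight) *~ m = ((a * m, b * m) : coweight).
Proof.
have D n : ((a, b) : coweight) *+ n = ((a *+ n, b *+ n) : coweight).
  by elim: n => // n IH; rewrite !mulrS IH.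
case: m => n; first by rewrite /intmul D -[a *+ _]mulr_natr -[b *+ _]mulr_natr !natz.
by rewrite NegzE mulrNz -pmulrn D !mulrN -[a *+ _]mulr_natr -[b *+ _]mulr_natr !natz.
Qed.

Lemma act_r1E x : act r1 x = (- x.1, x.1 + x.2).
Proof. by rewrite /act !tperm_val !coord3E /=; congr pair; lia. Qed.

Lemma act_r2E x : act r2 x = (x.1 + x.2, - x.2).
Proof. by rewrite /act !tperm_val !coord3E /=; congr pair; lia. Qed.

Lemma act_r1 x : act r1 x = x - alpha1 *~ x.1.
Proof. by case: x => a b; rewrite coweight_mulz act_r1E; congr pair => /=; lia. Qed.

Lemma act_r2 x : act r2 x = x - alpha2 *~ x.2.
Proof. by case: x => a b; rewrite coweight_mulz act_r2E; congr pair => /=; lia. Qed.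

Lemma permI3 (w u : 'S_3) : w i0 = u i0 -> w i1 = u i1 -> w i2 = u i2 -> w = u.
Proof. by move=> *; apply/permP; elim/I3_cases. Qed.

Lemma r11 : (r1 * r1 = 1)%g. Proof. exact: tperm2. Qed.
Lemma r22 : (r2 * r2 = 1)%g. Proof. exact: tperm2. Qed.

Lemma r12_braid : (r1 * r2 * r1 = r2 * r1 * r2)%g.
Proof. by apply: permI3; rewrite !permM !tperm_val. Qed.

Lemma tperm02E : tperm i0 i2 = (r1 * r2 * r1)%g.
Proof. by apply: permI3; rewrite !permM !tperm_val. Qed.

Lemma conj_r1 : (r1 ^ tperm i0 i2 = r2)%g.
Proof. by apply: permI3; rewrite conjgE tpermV !permM !tperm_val. Qed.

Lemma conj_r2 : (r2 ^ tperm i0 i2 = r1)%g.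
Proof. by apply: permI3; rewrite conjgE tpermV !permM !tperm_val. Qed.

Lemma deltaM x y : delta (x * y)%g = (delta x * delta y)%g.
Proof.
case: x y => x w [y u]; rewrite /delta /= conjMg ext_mulE; congr Ext.
rewrite conjgE tpermV tperm02E !actM.
have E z : act r1 (act r2 (act r1 z)) = (- z.2, - z.1).
  by case: z => a b; rewrite act_r1E act_r2E act_r1E /=; congr pair; lia.
case: y => a b; rewrite !E /= (_ : (- a, - b) = - ((a, b) : coweight)) //.
have N i : coord3 (- ((a, b) : coweight)) i = - coord3 (a, b) i.
  by elim/I3_cases: i; rewrite !coord3E /= ?oppr0 ?opprD.
by rewrite !N; congr pair => /=; lia.
Qed.

Lemma delta_s1 : delta s1 = s2.
Proof. by rewrite /delta /= conj_r1. Qed.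

Lemma delta_s2 : delta s2 = s1.
Proof. by rewrite /delta /= conj_r2. Qed.

Lemma s0E : s0 = Ext (1, 1) (r1 * r2 * r1)%g.
Proof. by rewrite /s0 !ext_mulE !act0 !addr0 mul1g. Qed.

Lemma tauE : tau = Ext (1, 0) (r1 * r2)%g.
Proof. by rewrite /tau !ext_mulE !act0 !addr0 mul1g. Qed.

Lemma delta_s0 : delta s0 = s0.
Proof. by rewrite s0E /delta /= !conjMg conj_r1 conj_r2 r12_braid. Qed.

Definition act_rE := (act_r1E, act_r2E).

Lemma tau3 : (tau ^+ 3 = 1)%g.
Proof.
rewrite !expgS expg0 mulg1 tauE !ext_mulE !actM !act_rE.
by congr Ext; apply: permI3; rewrite !permM !tperm_val perm1.
Qed.

Lemma tau_s0 : (tau * s0 * tau^-1 = s1)%g.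
Proof.
apply: (canLR (mulgK _)); rewrite s0E tauE !ext_mulE !actM !act_rE.
by congr Ext; apply: permI3; rewrite !permM !tperm_val.
Qed.

Lemma tau_s1 : (tau * s1 * tau^-1 = s2)%g.
Proof.
apply: (canLR (mulgK _)); rewrite tauE !ext_mulE !actM !act_rE.
by congr Ext; apply: permI3; rewrite !permM !tperm_val.
Qed.

Lemma tau_s2 : (tau * s2 * tau^-1 = s0)%g.
Proof.
apply: (canLR (mulgK _)); rewrite s0E tauE !ext_mulE !actM !act_rE.
by congr Ext; apply: permI3; rewrite !permM !tperm_val.
Qed.

Lemma delta_tau : delta tau = tau^-1%g.
Proof.
apply: (mulIg tau); rewrite mulVg tauE /delta /= conjMg conj_r1 conj_r2.
by rewrite ext_mulE actM !act_rE; congr Ext; apply: permI3;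
  rewrite !permM !tperm_val perm1.
Qed.
Definition srefl (i : 'I_3) : ext_weyl := nth s0 [:: s0; s1; s2] i.

(* x = w tau^j, with w a product of n generators of the Coxeter group W_a *)
Definition has_expr (x : ext_weyl) (n : nat) : Prop :=
  exists (u : n.-tuple 'I_3) (j : nat),
    x = ((\prod_(i <- u) srefl i) * tau ^+ j)%g.

Definition expressible (x : ext_weyl) : Prop := exists n, has_expr x n.

Lemma tau_srefl i : (tau * srefl i)%g = (srefl (ordS i) * tau)%g.
Proof.
elim/I3_cases: i; apply: (canRL (mulgVK _)); rewrite /srefl /=.
- exact: tau_s0.
- exact: tau_s1.
- exact: tau_s2.
Qed.

Lemma tau_prod_srefl (s : seq 'I_3) :
  (tau * \prod_(i <- s) srefl i = (\prod_(i <- s) srefl (ordS i)) * tau)%g.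
Proof.
move: tau tau_srefl => x xE.
elim: s => [|i s IH]; first by rewrite !big_nil mulg1 mul1g.
by rewrite !big_cons mulgA xE -mulgA IH mulgA.
Qed.

Lemma expr_tau x : expressible x -> expressible (tau * x)%g.
Proof.
case=> n [u [j ->]]; exists n, (map_tuple (@ordS 3) u), j.+1.
rewrite big_map; move: (tau_prod_srefl u); move: tau => y yE.
by rewrite expgS !mulgA yE.
Qed.

Lemma expr_srefl i x : expressible x -> expressible (srefl i * x)%g.
Proof.
case=> n [u [j ->]]; exists n.+1, [tuple of i :: u], j.
by rewrite big_cons mulgA.
Qed.

Lemma expr_fin w : expressible (Ext 0 w).
Proof.
have S1 u : expressible (Ext 0 u) -> expressible (Ext 0 (r1 * u)%g).
  by move/(expr_srefl i1); rewrite /srefl /= ext_mulE act0 addr0.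
have S2 u : expressible (Ext 0 u) -> expressible (Ext 0 (r2 * u)%g).
  by move/(expr_srefl i2); rewrite /srefl /= ext_mulE act0 addr0.
have S3 u : expressible (Ext 0 u) -> expressible (Ext 0 (tperm i0 i2 * u)%g).
  by move=> Hu; rewrite tperm02E -!mulgA; apply/S1/S2/S1.
have [ts -> _] := prod_tpermP w.
elim: ts => [|[i j] ts IH].
  by rewrite big_nil; exists 0%N, [tuple], 0%N; rewrite big_nil mulg1.
rewrite big_cons /=; elim/I3_cases: i; elim/I3_cases: j;
  rewrite ?tperm1 ?mul1g //.
- exact: S1.
- exact: S3.
- by rewrite tpermC; apply: S1.
- exact: S2.
- by rewrite tpermC; apply: S3.
- by rewrite tpermC; apply: S2.
Qed.

Lemma s11 : (s1 * s1 = 1)%g.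
Proof. by rewrite ext_mulE r11 act0 addr0. Qed.

Lemma s22 : (s2 * s2 = 1)%g.
Proof. by rewrite ext_mulE r22 act0 addr0. Qed.

Lemma t_omega1 : t omega1 = (tau * s2 * s1)%g.
Proof. by rewrite /tau -!(mulgA (_ * _)%g) (mulgA s2) s22 mul1g -mulgA s11 mulg1. Qed.

Lemma tV x : t (- x) = (t x)^-1%g.
Proof. by apply: (mulIg (t x)); rewrite mulVg ext_mulE act1 addNr mulg1. Qed.

Lemma delta_t x : delta (t x) = t (x.2, x.1).
Proof. by rewrite /delta /= conj1g. Qed.

Lemma t_omega2 : t omega2 = (tau^-1 * s1 * s2)%g.
Proof.
by rewrite -[t omega2](delta_t omega1) t_omega1 (deltaM (tau * s2)%g) (deltaM tau)
  delta_s1 delta_s2 delta_tau.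
Qed.

Lemma s1V : (s1^-1 = s1)%g. Proof. by apply: (mulIg s1); rewrite mulVg s11. Qed.
Lemma s2V : (s2^-1 = s2)%g. Proof. by apply: (mulIg s2); rewrite mulVg s22. Qed.
Lemma tauV : (tau^-1 = tau * tau)%g.
Proof. by apply: (mulIg tau); rewrite mulVg -(mulgA tau); symmetry; exact: tau3. Qed.

Lemma expr_trans x w : expressible (Ext x w).
Proof.
have S1 y : expressible y -> expressible (s1 * y)%g := @expr_srefl i1 y.
have S2 y : expressible y -> expressible (s2 * y)%g := @expr_srefl i2 y.
have := t_omega1; have := t_omega2; have := tauV; have := expr_tau.
move: tau => y0 ET VE E2 E1.
have T1 y : expressible y -> expressible (t omega1 * y)%g.
  by move=> Hy; rewrite E1 -!mulgA; apply/ET/S2/S1.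
have T1V y : expressible y -> expressible (t (- omega1) * y)%g.
  move=> Hy; rewrite tV E1 !invgM s1V s2V VE -!mulgA.
  by apply/S1/S2/ET/ET.
have T2 y : expressible y -> expressible (t omega2 * y)%g.
  by move=> Hy; rewrite E2 VE -!mulgA; apply/ET/ET/S1/S2.
have T2V y : expressible y -> expressible (t (- omega2) * y)%g.
  move=> Hy; rewrite tV E2 !invgM invgK s1V s2V -!mulgA.
  by apply/S2/S1/ET.
have tE (y : coweight) z u : (t y * Ext z u)%g = Ext (y + z) u.
  by rewrite ext_mulE act1 mul1g.
have H2 (b : int) : expressible (Ext (0, b) w).
  elim/int_rect: b => [|n /T2|n /T2V]; first exact: expr_fin.
  - by rewrite tE; congr expressible; congr Ext; congr pair => /=; lia.
  - by rewrite tE; congr expressible; congr Ext; congr pair => /=; lia.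
case: x => a b; elim/int_rect: a => [|n /T1|n /T1V]; first exact: H2.
- by rewrite tE; congr expressible; congr Ext; congr pair => /=; lia.
- by rewrite tE; congr expressible; congr Ext; congr pair => /=; lia.
Qed.

Lemma has_expr_exists x : exists n, `[< has_expr x n >].
Proof. by case: x => x w; have [n ?] := expr_trans x w; exists n; apply/asboolP. Qed.

(* The unique integer n such that x = w tau^j with w in W_a of Coxeter length n *)
Definition len (x : ext_weyl) : nat := ex_minn (has_expr_exists x).

Definition delta_class (x : ext_weyl) : set ext_weyl :=
  [set y | exists z, y = (z * x * (delta z)^-1)%g].

Definition delta_classes : set (set ext_weyl) := range delta_class.

Definition min_length (O : set ext_weyl) (x : ext_weyl) : Prop :=
  O x /\ forall y, O y -> (len x <= len y)%N.

Definition hat (X : set ext_weyl) : set ext_weyl :=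
  X `|` [set (tau * x * tau^-1 * tau ^+ 2)%g | x in X]
    `|` [set (tau ^+ 2 * x * (tau ^+ 2)^-1 * tau)%g | x in X].

Definition O1 : set ext_weyl :=
  hat [set x | exists2 y, root_lattice y & x = (t y * s1)%g \/ x = (t y * s2)%g].

Definition tQ (a b : int) : ext_weyl := t (alpha1 *~ a + alpha2 *~ b).
Arguments tQ (a b)%_R.

(* [Oeven m] is O_{2m}; [odd m] is epsilon(m), and [m./2] and [m.+1./2] are the
   floors of m/2 and (m+1)/2. *)
Definition Oeven (m : nat) : set ext_weyl :=
  hat [set x | exists k : int, x \in
    [:: (tQ (k - m./2%:Z) (2 * k + (odd m)%:Z) * s2 * s1)%g;
        (tQ (k + m.+1./2%:Z) (2 * k + (odd m)%:Z) * s2 * s1)%g;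
        (tQ (2 * k + (odd m)%:Z) (k + m.+1./2%:Z) * s1 * s2)%g;
        (tQ (2 * k + (odd m)%:Z) (k - m./2%:Z) * s1 * s2)%g;
        tQ k (m%:Z - k);
        tQ (k - m%:Z) (- k)]].

Local Notation frac := {fraction {poly int}}.
Local Notation "p %:F" := (tofrac p).

Definition is_laurent : {pred frac} := fun x =>
  `[< exists (n : nat) (p : {poly int}), x * 'X%:F ^+ n = p%:F >].

Lemma is_laurent_subring : subring_closed is_laurent.
Proof.
split.
- by apply/asboolP; exists 0%N, 1; rewrite expr0 mulr1 tofrac1.
- move=> x y /asboolP[n [p xp]] /asboolP[m [q yq]]; apply/asboolP.
  exists (n + m)%N, (p * 'X ^+ m - q * 'X ^+ n).
  by rewrite tofracB !tofracM !tofracXn -xp -yq exprD; ring.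
- move=> x y /asboolP[n [p xp]] /asboolP[m [q yq]]; apply/asboolP.
  by exists (n + m)%N, (p * q); rewrite tofracM -xp -yq exprD mulrACA.
Qed.

HB.instance Definition _ :=
  GRing.isSubringClosed.Build frac is_laurent is_laurent_subring.

Record laurent := Laurent { laurent_val : frac; _ : laurent_val \in is_laurent }.
HB.instance Definition _ := [isSub for laurent_val].
HB.instance Definition _ := [Choice of laurent by <:].
HB.instance Definition _ := [SubChoice_isSubComNzRing of laurent by <:].

Lemma is_laurent_v : 'X%:F \in is_laurent.
Proof. by apply/asboolP; exists 0%N, 'X; rewrite expr0 mulr1. Qed.

Lemma is_laurent_vV : 'X%:F^-1 \in is_laurent.
Proof.
apply/asboolP; exists 1%N, 1.
by rewrite expr1 mulVf ?tofrac1 // tofrac_eq0 polyX_eq0.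
Qed.

Definition v : laurent := Laurent is_laurent_v.
Definition vV : laurent := Laurent is_laurent_vV.

Lemma mulvV : v * vV = 1.
Proof. by apply: val_inj; rewrite /= mulfV // tofrac_eq0 polyX_eq0. Qed.

Definition is_basis (M : lmodType laurent) (I : eqType) (b : I -> M) : Prop :=
  (forall x, exists (s : seq I) (c : I -> laurent), x = \sum_(i <- s) c i *: b i)
  /\ (forall (s : seq I) (c : I -> laurent), uniq s ->
      \sum_(i <- s) c i *: b i = 0 -> forall i, i \in s -> c i = 0).

(* These conditions determine the algebra H with its basis T up to a unique
   isomorphism; in particular T 1 = 1. *)
Definition is_hecke (H : algType laurent) (T : ext_weyl -> H) : Prop :=
  [/\ is_basis T,
      forall x y, (len x + len y = len (x * y)%g)%N -> T x * T y = T (x * y)%g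
    & forall i : 'I_3, (T (srefl i) - v%:A) * (T (srefl i) + vV%:A) = 0].

(* The submodule [H, H]_delta, dH being the action of delta on H *)
Definition cocomm (H : algType laurent) (dH : H -> H) : set H :=
  [set x | exists s : seq (laurent * (H * H)),
    x = \sum_(p <- s) p.1 *: (p.2.1 * p.2.2 - p.2.2 * dH p.2.1)].

(* f, extended by 0 outside the delta-conjugacy classes, is a finitely supported
   family of coefficients expressing T_x in terms of the T_O modulo
   [H, H]_delta, whatever the choice m of minimal length representatives. *)
Definition is_class_poly (H : algType laurent) (T : ext_weyl -> H) (dH : H -> H)
    (x : ext_weyl) (f : set ext_weyl -> laurent) : Prop :=
  [/\ finite_set [set O | f O != 0],
      [set O | f O != 0] `<=` delta_classes
    & forall m : set ext_weyl -> ext_weyl,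
        (forall O, delta_classes O -> min_length O (m O)) ->
        cocomm dH (T x - \sum_(O \in delta_classes) f O *: T (m O))].

(* [xget] picks an unspecified element of the set (0 if there is none), so that
   nothing about [class_poly] is granted before the existence and the uniqueness
   of the class polynomials are established. *)
Definition class_poly (H : algType laurent) (T : ext_weyl -> H) (dH : H -> H)
    (x : ext_weyl) : set ext_weyl -> laurent :=
  xget (fun=> 0) [set f | is_class_poly T dH x f].

(* Main.v *)
Require Import Defs.
From HB Require Import structures.
From mathcomp Require Import all_boot all_order all_fingroup all_algebra.
From mathcomp Require Import zify ring.
From mathcomp Require Import boolp classical_sets functions cardinality fsbigop.

(* Put xi = v - v^-1.

   Existence. If s w is shorter than w and s w delta(s) is shorter by 2, then
   T_w = T_(s w delta(s)) + xi T_(s w) modulo [H, H]_delta. Up to conjugation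
   by tau and delta, an element of O1 of length 2k + 1 >= 3 becomes such a w
   after at most one length-preserving delta-conjugation by a simple
   reflection, and s w is then a minimal length element of O_2k; one concludes
   by induction on k.

   Uniqueness. A function phi on the extended affine Weyl group extends to a
   linear form on H vanishing on [H, H]_delta as soon as phi(tau w tau) = phi(w)
   and phi(s w) + [s w < w] xi phi(w) =
   phi(w delta(s)) + [w delta(s) < w] xi phi(w) for every simple reflection s.
   This holds for the indicator function of a class all of whose elements
   satisfy w delta(w) = 1, because then delta(w) = w^-1; every class other than
   O1 and O_2m (m >= 1) is of this kind. It also holds for w |-> v^ell(w) and
   for explicit functions sep j (j >= 1) that vanish at the minimal length
   elements of O1 and take the value [m = j] - [m = j + 2] at those of O_2m. In
   a linear relation between the T_O, the indicators kill the coefficients of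
   the first kind, sep j shows that O_2j and O_2(j+2) have the same coefficient,
   which is 0 as the relation is finite, and v^ell kills the coefficient of
   O1. *)

Set Implicit Arguments.
Unset Strict Implicit.
Unset Printing Implicit Defensive.

Import Order.TTheory GRing.Theory Num.Theory.

Local Open Scope classical_set_scope.
Local Open Scope ring_scope.

(** * The length formula *)

(* The Iwahori-Matsumoto formula for the length of t^(a, b) u *)
Definition ell (x : ext_weyl) : nat :=
  let: (a, b) := trans_part x in let u := fin_part x in
  (absz (a - (u i1 < u i0)%N%:Z)%R + absz (b - (u i2 < u i1)%N%:Z)%R +
   absz (a + b - (u i2 < u i0)%N%:Z)%R)%N.

(** Listing the six finite parts turns statements about [ell] into linear integer arithmetic with
    absolute values. *)
Lemma S3_ind (P : 'S_3 -> Prop) :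
  P 1%g -> P r1 -> P r2 -> P (r1 * r2)%g -> P (r2 * r1)%g -> P (r1 * r2 * r1)%g ->
  forall u, P u.
Proof.
move=> P1 Pr1 Pr2 Pr12 Pr21 Pw0 u.
have inj i j : (i == j) = false -> u i <> u j by move=> /eqP ij /perm_inj.
move: (inj i0 i1 erefl) (inj i0 i2 erefl) (inj i1 i2 erefl).
move E0: (u i0) => x0; move E1: (u i1) => x1; move E2: (u i2) => x2.
elim/I3_cases: x0 E0 => E0; elim/I3_cases: x1 E1 => E1;
  elim/I3_cases: x2 E2 => E2 // _ _ _.
- by rewrite (_ : u = 1%g) //; apply: permI3; rewrite perm1.
- by rewrite (_ : u = r2) //; apply: permI3; rewrite tperm_val.
- by rewrite (_ : u = r1) //; apply: permI3; rewrite tperm_val.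
- by rewrite (_ : u = (r2 * r1)%g) //; apply: permI3; rewrite permM !tperm_val.
- by rewrite (_ : u = (r1 * r2)%g) //; apply: permI3; rewrite permM !tperm_val.
- by rewrite (_ : u = (r1 * r2 * r1)%g) //; apply: permI3; rewrite !permM !tperm_val.
Qed.

Lemma sreflE : (srefl i0 = s0) * (srefl i1 = s1) * (srefl i2 = s2).
Proof. by []. Qed.

Lemma fin_refl : (s1 = Ext 0 r1) * (s2 = Ext 0 r2).
Proof. by []. Qed.

Ltac ext_cases x := case: x => [[? ?]]; elim/S3_ind.
Ltac ext_eval := rewrite ?(sreflE, s0E, tauE, fin_refl)
  ?(ext_mulE, Defs.actM, act_rE, Defs.act1, Defs.act0, add0r) /=
  ?(permM, tperm_val, perm1) /=.

Lemma ell_srefl i x :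
  ell (srefl i * x)%g = (ell x).+1 \/ (ell (srefl i * x)%g).+1 = ell x.
Proof. by elim/I3_cases: i; ext_cases x; ext_eval; rewrite /ell; ext_eval; lia. Qed.

Lemma ell_tau x : ell (tau * x)%g = ell x.
Proof. by ext_cases x; ext_eval; rewrite /ell; ext_eval; lia. Qed.

Lemma ell_mul_tau x : ell (x * tau)%g = ell x.
Proof. by ext_cases x; ext_eval; rewrite /ell; ext_eval; lia. Qed.

Lemma ell_mul_srefl i x :
  ell (x * srefl i)%g = (ell x).+1 \/ (ell (x * srefl i)%g).+1 = ell x.
Proof.
by elim/I3_cases: i; ext_cases x; ext_eval; rewrite /ell; ext_eval; lia.
Qed.

Lemma ell_delta x : ell (delta x) = ell x.
Proof.
by ext_cases x; rewrite /delta /= ?conjMg ?(conj_r1, conj_r2, conj1g) /ell; ext_eval; lia.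
Qed.

(** An element without left descent preserves the base alcove, hence has length 0. *)
Lemma ell_neq0P x : ell x <> 0%N -> exists i, (ell (srefl i * x)%g).+1 = ell x.
Proof.
move=> Lx; have [|E0] := boolP (ell (s0 * x)%g < ell x)%N.
  by move=> Lt; exists i0; have := ell_srefl i0 x; rewrite /srefl /=; lia.
have [|E1] := boolP (ell (s1 * x)%g < ell x)%N.
  by move=> Lt; exists i1; have := ell_srefl i1 x; rewrite /srefl /=; lia.
exists i2; rewrite /srefl /=; move: Lx E0 E1.
by ext_cases x; ext_eval; rewrite /ell; ext_eval; lia.
Qed.

Lemma ell_eq0 x : ell x = 0%N -> exists j : nat, x = (tau ^+ j)%g.
Proof.
ext_cases x; rewrite /ell; ext_eval => L0.
- exists 0%N; congr Ext; congr pair; lia.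
- lia.
- lia.
- exists 1%N; rewrite expg1; congr Ext; congr pair; lia.
- exists 2%N; rewrite expgS expg1; ext_eval; congr Ext.
    by congr pair => /=; lia.
  by apply: permI3; rewrite !permM !tperm_val.
- lia.
Qed.

Lemma ell_prod (u : seq 'I_3) j :
  (ell ((\prod_(i <- u) srefl i) * tau ^+ j)%g <= size u)%N.
Proof.
elim: u => [|i u IH] /=.
  rewrite big_nil mul1g leqn0; apply/eqP; elim: j => [|j IH].
    by rewrite expg0 /ell; ext_eval.
  by rewrite expgS ell_tau.
rewrite big_cons -mulgA.
case: (ell_srefl i ((\prod_(k <- u) srefl k) * tau ^+ j)%g) => [->|E] //.
by rewrite (leq_trans _ (leqW IH)) // -E leqnSn.
Qed.

Lemma srefl2 i : (srefl i * srefl i = 1)%g.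
Proof.
elim/I3_cases: i; rewrite sreflE ?s11 ?s22 //.
by ext_eval; congr Ext; apply: permI3; rewrite !permM !tperm_val perm1.
Qed.

Lemma has_expr_ell x : has_expr x (ell x).
Proof.
move Ln: (ell x) => n; elim: n x Ln => [|n IH] x Ln.
  by have [j ->] := ell_eq0 Ln; exists [tuple], j; rewrite big_nil mul1g.
have [i] : exists i, (ell (srefl i * x)%g).+1 = ell x by apply: ell_neq0P; lia.
rewrite Ln => -[/IH[u [j xE]]]; exists [tuple of i :: u], j.
by rewrite big_cons -mulgA -xE mulgA srefl2 mul1g.
Qed.

(** A generator changes [ell] by one and [tau] preserves it, so [ell] is a lower bound for every
    expression; removing left descents one by one attains it. *)
Lemma lenE x : len x = ell x.
Proof.
rewrite /len; case: ex_minnP => n /asboolP[u [j xE]] le_n.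
apply/eqP; rewrite eqn_leq le_n ?{1}xE; last exact/asboolP/has_expr_ell.
by rewrite (leq_trans (ell_prod _ _)) ?size_tuple.
Qed.

(** * The functions sep *)

(* With f_m the class polynomial of O_2m, the function [sep j] below is the
   difference f_j - f_(j+2): on an element w with w delta(w) = 1 the f_m involve
   quadratic polynomials in the coordinates of w, whereas [om3 j], the
   coefficient of xi ^ 3 in their difference, is piecewise linear. *)
Definition cut (j n : nat) : nat := minn (n - j) 2.

Definition om1 (j : nat) (p : nat * nat * nat) : int :=
  let: (a, b, c) := p in (a == j.+1)%:Z + (b == j.+1)%:Z + (c == j.+1)%:Z.

Definition om3 (j : nat) (p : nat * nat * nat) : int :=
  let: (a, b, c) := p in let m := maxn a (maxn b c) in
  (a + b + c - m - j.+1)%N%:Z + (m - j.+1)%N%:Z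
  - (a - j.+1)%N%:Z - (b - j.+1)%N%:Z - (c - j.+1)%N%:Z.

Arguments om1 : simpl never.
Arguments om3 : simpl never.

Definition rho0 (j n : nat) : int := (n == j)%:Z - (n == j.+2)%:Z.

Lemma om3C j a b c : om3 j (a, b, c) = om3 j (b, a, c).
Proof. by rewrite /om3 maxnCA (addnC a b); congr (_ - _); rewrite addrAC. Qed.

(** The term of the largest entry cancels, so [om3] depends only on the two smaller ones; truncated
    subtraction makes each term a positive part. *)
Lemma om3_max j a b c : (a <= c)%N -> (b <= c)%N -> om3 j (a, b, c) =
  (a + b - j.+1)%N%:Z - (a - j.+1)%N%:Z - (b - j.+1)%N%:Z.
Proof.
by move=> ac bc; rewrite /om3 (maxn_idPr bc) (maxn_idPr ac) addnK; ring.
Qed.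

Lemma om3_max1 j a b c : (b <= a)%N -> (c <= a)%N -> om3 j (a, b, c) =
  (b + c - j.+1)%N%:Z - (b - j.+1)%N%:Z - (c - j.+1)%N%:Z.
Proof.
move=> ba ca; rewrite /om3 (@maxn_idPl a _ _) ?geq_max ?ba //.
by rewrite -addnA addKn; ring.
Qed.

Lemma om1_step j c a b : (0 < j)%N -> (0 < c)%N ->
  om1 j (a, b, c.-1) + rho0 j c = om1 j (a, b, c.+1).
Proof. by rewrite /om1 /rho0; lia. Qed.

(** [cut j n] is the increment of the positive part of [x - (j + 1)] between [x = n - 1] and
    [x = n + 1]. If [a] or [b] is the sum of the other two, the change of [om3] is a difference of
    two such increments; if [c] is, [om3] does not change. *)
Lemma om3_step j a b c : (0 < c)%N -> [\/ c = a + b, a = b + c | b = a + c]%N ->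
  om3 j (a, b, c.-1) + ((cut j (maxn a (maxn b c)))%:Z - (cut j c)%:Z) =
  om3 j (a, b, c.+1).
Proof.
move=> c0.
have H a' b' : a' = (b' + c)%N ->
  om3 j (a', b', c.-1) + ((cut j (maxn a' (maxn b' c)))%:Z - (cut j c)%:Z) =
  om3 j (a', b', c.+1).
  move=> E; have [b0|b0] := posnP b'.
    rewrite [RHS]om3_max ?[in LHS]om3_max1; try lia.
    rewrite (_ : maxn _ _ = c); lia.
  rewrite !om3_max1; try lia.
  rewrite (_ : maxn _ _ = a'); last lia.
  rewrite /cut; lia.
case=> E; last first.
- rewrite !(om3C _ a b) -(H _ _ E) maxnCA //.
- exact: H.
rewrite (_ : maxn _ _ = c); last lia.
rewrite subrr addr0 [RHS]om3_max; try lia.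
have [a0|a0] := posnP a; first by rewrite om3C om3_max1; lia.
have [b0|b0] := posnP b; first by rewrite om3_max1; lia.
by rewrite om3_max; lia.
Qed.

(** * Delta-conjugation by [tau], and the invariants of delta-conjugation *)

Definition twist x : ext_weyl := (tau * x * tau)%g.

Lemma delta_srefl_tau i :
  (delta (srefl i) * tau = tau * delta (srefl (ordS i)))%g.
Proof.
have := congr1 delta (tau_srefl i).
rewrite (deltaM tau) (deltaM (srefl _)) delta_tau => E.
by apply: (mulgI tau^-1%g); rewrite mulgA E -mulgA mulVg mulg1 mulKg.
Qed.

Lemma twist_srefl i x : twist (srefl i * x)%g = (srefl (ordS i) * twist x)%g.
Proof.
by move: (tau_srefl i); rewrite /twist; move: tau => y yE; rewrite mulgA yE !mulgA.
Qed.

Lemma twist_delta_srefl i x :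
  twist (x * delta (srefl i))%g = (twist x * delta (srefl (ordS i)))%g.
Proof.
by move: (delta_srefl_tau i); rewrite /twist; move: tau => y yE; rewrite -!mulgA -yE.
Qed.

Lemma ell_twist x : ell (twist x) = ell x.
Proof. by rewrite /twist ell_mul_tau ell_tau. Qed.

Definition even_fin x := ~~ odd_perm (fin_part x).

(* For x of odd finite part, this singles out the longest element of 'S_3, that
   is, the x such that x delta is a point reflection. *)
Definition central x := fin_part x i1 == i1.

(* For x of even finite part, x delta is a glide reflection, and [zabs x] is its
   translation length, up to scale: |a + b| for x = t^(a, b), extended to the
   other rotation parts by invariance under x |-> tau x tau. *)
Definition zabs (x : ext_weyl) : nat :=
  let: (a, b) := trans_part x in
  match val (fin_part x i0) with 0 => absz (a + b)%R | 1 => absz a | _ => absz b end.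

(* For central x, these three numbers add up to [ell x]. *)
Definition abs3 (x : ext_weyl) : nat * nat * nat :=
  let: (a, b) := trans_part x in
  (absz (a - 1)%R, absz (b - 1)%R, absz (a + b - 1)%R).

Lemma odd_perm_refl : (odd_perm r1 = true) * (odd_perm r2 = true).
Proof. by rewrite !odd_tperm. Qed.

Lemma even_finM x y : even_fin (x * y)%g = (even_fin x == even_fin y).
Proof.
case: x y => [l u] [m w]; rewrite /even_fin ext_mulE /= odd_permM.
by case: (odd_perm u); case: (odd_perm w).
Qed.

Ltac parity := rewrite /even_fin /= ?odd_permM ?odd_perm_refl ?odd_perm1 //=.

Lemma even_srefl i : even_fin (srefl i) = false.
Proof. by elim/I3_cases: i; rewrite sreflE; ext_eval; parity. Qed.

Lemma even_tau : even_fin tau.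
Proof. by ext_eval; parity. Qed.

Lemma even_delta x : even_fin (delta x) = even_fin x.
Proof. by rewrite /even_fin /delta /= odd_permJ. Qed.

Lemma even_twist x : even_fin (twist x) = even_fin x.
Proof.
rewrite /twist; move: even_tau; move: tau => y; rewrite !even_finM => ->.
by case: even_fin.
Qed.

Lemma even_ell x : even_fin x = ~~ odd (ell x).
Proof. by ext_cases x; parity; rewrite /ell; ext_eval; lia. Qed.

Lemma central_twist x : ~~ even_fin x -> central (twist x) = central x.
Proof.
ext_cases x; parity => _; rewrite /twist; ext_eval; rewrite /central; ext_eval;
  by rewrite ?i_neq ?eqxx.
Qed.

Lemma zabs_twist x : even_fin x -> zabs (twist x) = zabs x.
Proof.
by ext_cases x; parity => _; rewrite /twist; ext_eval; rewrite /zabs; ext_eval; lia.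
Qed.

Lemma abs3_twist x : ~~ even_fin x -> central x ->
  abs3 (twist x) = ((abs3 x).2, (abs3 x).1.1, (abs3 x).1.2).
Proof.
ext_cases x; parity => _; rewrite /central; ext_eval; rewrite ?i_neq // => _.
by rewrite /twist; ext_eval; rewrite /abs3 /=; congr (_, _, _); lia.
Qed.

(** As [x delta(s)] is the delta-conjugate of [s x] by [s], this is the conjugation invariance of
    the translation length. *)
Lemma zabs_conj i x : ~~ even_fin x ->
  zabs (srefl i * x)%g = zabs (x * delta (srefl i))%g.
Proof.
elim/I3_cases: i; ext_cases x; parity => _;
  rewrite sreflE ?(delta_s1, delta_s2, delta_s0); ext_eval; rewrite /zabs; ext_eval; lia.
Qed.

Lemma central_conj i x : even_fin x ->
  central (srefl i * x)%g = central (x * delta (srefl i))%g.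
Proof.
elim/I3_cases: i; ext_cases x; parity => _;
  rewrite sreflE ?(delta_s1, delta_s2, delta_s0); ext_eval;
  by rewrite /central; ext_eval; rewrite ?i_neq ?eqxx.
Qed.

(** [twist] permutes the three even finite parts cyclically. *)
Lemma twist_trans x : even_fin x -> exists n (a b : int), iter n twist x = t (a, b).
Proof.
ext_cases x; parity => _.
- by exists 0%N; eexists; eexists.
- exists 1%N; rewrite /= /twist; ext_eval; eexists; eexists; congr Ext.
  by apply: permI3; rewrite !permM !tperm_val perm1.
- exists 2%N; rewrite /= /twist; ext_eval; eexists; eexists; congr Ext.
  by apply: permI3; rewrite !permM !tperm_val perm1.
Qed.

Lemma zabs_le_ell x : even_fin x -> ((zabs x).*2 <= ell x)%N.
Proof. by ext_cases x; parity => _; rewrite /zabs /ell; ext_eval; lia. Qed.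

(** * Trace functions on the extended affine Weyl group *)

Definition xi : laurent := v - vV.

(** The two sides are the values of the linear extension of [phi] at [T s * T x] and at
    [T x * T (delta s)]. *)
Definition trace_rel (phi : ext_weyl -> laurent) i x :=
  phi (srefl i * x)%g + (ell (srefl i * x)%g < ell x)%N%:R * xi * phi x =
  phi (x * delta (srefl i))%g + (ell (x * delta (srefl i))%g < ell x)%N%:R * xi * phi x.

Definition is_trace phi :=
  (forall i x, trace_rel phi i x) /\ (forall x, phi (twist x) = phi x).

Lemma ell_mul_delta_srefl i x : ell (x * delta (srefl i))%g = (ell x).+1 \/
  (ell (x * delta (srefl i))%g).+1 = ell x.
Proof.
elim/I3_cases: i; rewrite sreflE ?(delta_s1, delta_s2, delta_s0).
- exact: (ell_mul_srefl i0).
- exact: (ell_mul_srefl i2).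
- exact: (ell_mul_srefl i1).
Qed.

(** This comes from the character of the Hecke algebra with [T s] sent to [v]: both sides of the
    relation equal [v ^+ (ell x).+1]. *)
Lemma is_trace_ell : is_trace (fun x => v ^+ ell x).
Proof.
split=> [i x|x]; last by rewrite ell_twist.
have E y : ell y = (ell x).+1 \/ (ell y).+1 = ell x ->
   v ^+ (ell y) + (ell y < ell x)%N%:R * xi * v ^+ ell x = v ^+ (ell x).+1.
  case=> [->|<-]; rewrite ?ltnSn.
    by rewrite ltnNge leqnSn !mul0r addr0.
  rewrite mul1r mulrBl -!exprS (exprS _ (ell y)) mulrA (mulrC vV) mulvV mul1r.
  by rewrite addrC subrK.
by rewrite /trace_rel (E _ (ell_srefl i x)) (E _ (ell_mul_delta_srefl i x)).
Qed.

Lemma ext_invE x w : ((Ext x w)^-1 = Ext (- Defs.act w^-1 x) w^-1)%g.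
Proof. by []. Qed.

Lemma ell_inv x : ell x^-1%g = ell x.
Proof.
ext_cases x; rewrite ext_invE ?invMg ?tpermV ?invg1; ext_eval; rewrite /ell; ext_eval; lia.
Qed.

Lemma delta1 : delta 1%g = 1%g.
Proof. by rewrite /delta /= conj1g. Qed.

Lemma delta_sreflV i : ((delta (srefl i))^-1 = delta (srefl i))%g.
Proof.
by apply: (mulIg (delta (srefl i))); rewrite mulVg -(deltaM (srefl i)) srefl2 delta1.
Qed.

(** Since [delta x] is the inverse of [x], applying [delta] to [s x] gives the inverse of
    [x delta(s)]; both operations preserve length. *)
Lemma ell_conj_inv i x : (x * delta x)%g = 1%g ->
  ell (srefl i * x)%g = ell (x * delta (srefl i))%g.
Proof.
move=> xdx; have dx : delta x = x^-1%g by apply: (mulgI x); rewrite xdx mulgV.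
by rewrite -(ell_inv (x * _)%g) invMg -dx delta_sreflV -(deltaM (srefl i)) ell_delta.
Qed.

Lemma is_trace_indic (P : ext_weyl -> bool) :
  (forall x, P x -> (x * delta x)%g = 1%g) ->
  (forall i x, P (srefl i * x)%g = P (x * delta (srefl i))%g) ->
  (forall x, P (twist x) = P x) -> is_trace (fun x => (P x)%:R).
Proof.
move=> Pinv Pconj PT; split=> [i x|x]; last by rewrite PT.
rewrite /trace_rel Pconj; congr (_ + _).
case Px: (P x); last by rewrite !mulr0.
by rewrite (ell_conj_inv i (Pinv x Px)).
Qed.

(** In the last case, with [ell x = 2k + 1], the integer factor is [j <= k] - [j + 2 <= k], as the
    theorem predicts for f_j - f_(j+2). *)
Definition sep (j : nat) (x : ext_weyl) : laurent :=
  if even_fin x then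
    (rho0 j (zabs x))%:~R +
    xi ^+ 2 * ((cut j (ell x)./2)%:Z - (cut j (zabs x))%:Z)%:~R
  else if central x then
    xi * (om1 j (abs3 x))%:~R + xi ^+ 3 * (om3 j (abs3 x))%:~R
  else xi * ((cut j (uphalf (ell x)))%:Z - (cut j (ell x)./2)%:Z)%:~R.

Lemma sep_twist j x : sep j (twist x) = sep j x.
Proof.
rewrite /sep even_twist ell_twist; case: ifP => ex; first by rewrite zabs_twist.
rewrite central_twist ?ex //; case: ifP => // cx.
rewrite abs3_twist ?ex //; case: (abs3 x) => [[a b] c] /=.
congr (_ * _%:~R + _ * _%:~R).
  by rewrite /om1 -addrA addrC.
by rewrite /om3 /=; lia.
Qed.

(** The two products have the same [zabs], and each side reduces to an expression in [zabs] and
    [ell x] alone. *)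
Lemma trace_rel_sep_nc j i x : ~~ even_fin x -> ~~ central x ->
  trace_rel (sep j) i x.
Proof.
move=> ex cx; rewrite /trace_rel {2 4}/sep (negbTE ex) (negbTE cx).
have E y : even_fin y -> ell y = (ell x).+1 \/ (ell y).+1 = ell x ->
    sep j y + (ell y < ell x)%N%:R * xi *
      (xi * ((cut j (uphalf (ell x)))%:Z - (cut j (ell x)./2)%:Z)%:~R) =
    (rho0 j (zabs y))%:~R +
      xi ^+ 2 * ((cut j (uphalf (ell x)))%:Z - (cut j (zabs y))%:Z)%:~R.
  move=> ey; rewrite /sep ey => Ly; rewrite -addrA; congr (_ + _).
  have oL : odd (ell x) by move: ex; rewrite even_ell negbK.
  case: Ly => Ly.
    rewrite Ly ltnNge leqnSn !mul0r addr0; congr (_ * (_ - _)%:~R).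
  rewrite -Ly ltnSn (_ : uphalf (ell y).+1 = (ell y)./2.+1); last by lia.
  rewrite (_ : (ell y).+1./2 = (ell y)./2); last by lia.
  rewrite mul1r mulrA -expr2 -mulrDr -rmorphD; congr (_ * _%:~R).
  by rewrite addrC addrA subrK.
rewrite (E _ _ (ell_srefl i x)) ?(E _ _ (ell_mul_delta_srefl i x)) ?zabs_conj //.
- by rewrite even_finM even_delta even_srefl (negbTE ex).
- by rewrite even_finM even_srefl (negbTE ex).
Qed.

(** The point reflection [x delta] is an involution. *)
Lemma central_inv x : ~~ even_fin x -> central x -> (x * delta x)%g = 1%g.
Proof.
ext_cases x; parity => _; rewrite /central; ext_eval; rewrite ?i_neq // => _.
rewrite /delta /= !conjMg conj_r1 conj_r2; ext_eval; congr Ext.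
  by congr pair => /=; lia.
by apply: permI3; rewrite !permM !tperm_val perm1.
Qed.

Lemma trace_rel_sep_central j i x : ~~ even_fin x -> central x ->
  trace_rel (sep j) i x.
Proof.
move=> ex cx; rewrite /trace_rel (ell_conj_inv i (central_inv ex cx)).
congr (_ + _); rewrite /sep even_finM (even_finM x) even_delta even_srefl.
by rewrite (negbTE ex) /= (ell_conj_inv i (central_inv ex cx)) zabs_conj.
Qed.

(** Either the two sides of the trace relation agree term by term, or [x] has minimal length in its
    class and the [xi ^+ 2] term of [sep j x] vanishes. *)
Lemma ell_or_zabs_conj i x : even_fin x -> ~~ central (srefl i * x)%g ->
  ell (srefl i * x)%g = ell (x * delta (srefl i))%g \/ ell x = (zabs x).*2.
Proof.
elim/I3_cases: i; ext_cases x; parity => _;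
  rewrite sreflE ?(delta_s1, delta_s2, delta_s0); ext_eval; rewrite /central;
  ext_eval; rewrite ?i_neq ?eqxx // => _;
  rewrite /ell /zabs; ext_eval; lia.
Qed.

(** The second difference of [cut j] is [rho0 j]. *)
Lemma cut_step j n : (0 < j)%N ->
  (cut j n.+1)%:Z - (cut j n)%:Z + rho0 j n.+1 = (cut j n.+2)%:Z - (cut j n.+1)%:Z.
Proof. by rewrite /cut /rho0; lia. Qed.

Lemma trace_rel_sep_even_nc j i x : (0 < j)%N -> even_fin x ->
  ~~ central (srefl i * x)%g -> trace_rel (sep j) i x.
Proof.
move=> j0 ex cx; rewrite /trace_rel.
have es : even_fin (srefl i * x)%g = false by rewrite even_finM even_srefl ex.
have es' : even_fin (x * delta (srefl i))%g = false.
  by rewrite even_finM even_delta even_srefl ex.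
rewrite /sep es es' ex -(central_conj i ex) (negbTE cx).
case: (ell_or_zabs_conj ex cx) => [->//|Lx].
have Ly := ell_srefl i x; have Lz := ell_mul_delta_srefl i x.
set y := ell (srefl i * x)%g in Ly *; set z := ell (x * _)%g in Lz *.
rewrite Lx doubleK subrr mulr0 addr0.
have R (a c : int) (b : bool) :
    xi * a%:~R + b%:R * xi * c%:~R = xi * (a + b%:Z * c)%:~R.
  by rewrite rmorphD rmorphM /=; ring.
rewrite !R; move: Ly Lz; rewrite Lx; move: (zabs x) => n Ly Lz; congr (_ * _%:~R).
(* The length of [x] is [2n], so each product has length [2n + 1] or [2n - 1]; both give the same
   value. *)
have E k : k = n.*2.+1 \/ k.+1 = n.*2 ->
    (cut j (uphalf k))%:Z - (cut j k./2)%:Z + (k < n.*2)%N%:Z * rho0 j n =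
    (cut j n.+1)%:Z - (cut j n)%:Z.
  case=> [->|kE].
    by rewrite ltnNge leqnSn mul0r addr0 /= doubleK uphalf_double.
  case: n {Ly Lz} kE => // m kE; rewrite -cut_step // doubleS.
  have -> : k = m.*2.+1 by rewrite doubleS in kE; case: kE.
  by rewrite ltnSn mul1r /= uphalf_double doubleK.
by rewrite !E.
Qed.

Lemma om1C j a b c : om1 j (a, b, c) = om1 j (b, a, c).
Proof. by rewrite /om1; congr (_ + _); rewrite addrC. Qed.

(** Both products are central, and up to order their [abs3] differ only in the entry [|a + b - 1|]
    against [|a + b + 1|]. Comparing the coefficients of [xi] and [xi ^+ 3] leaves [om1_step] and
    [om3_step] with [c = |a + b|]. *)
Lemma trace_rel_sep_trans j (a b : int) :
  (0 < j)%N -> trace_rel (sep j) i0 (t (a, b)).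
Proof.
move=> j0; rewrite /trace_rel sreflE delta_s0.
set x := t (a, b).
have lE : (s0 * x)%g = Ext (1 - b, 1 - a) (r1 * r2 * r1)%g.
  by rewrite /x; ext_eval; rewrite mulg1; congr Ext; congr pair => /=; lia.
have rE : (x * s0)%g = Ext (a + 1, b + 1) (r1 * r2 * r1)%g.
  by rewrite /x; ext_eval; rewrite mul1g; congr Ext; congr pair => /=; lia.
have ex : even_fin x by parity.
have es : even_fin (s0 * x)%g = false by rewrite lE; parity.
have es' : even_fin (x * s0)%g = false by rewrite rE; parity.
have cs : central (s0 * x)%g by rewrite lE /central; ext_eval.
have cs' : central (x * s0)%g by rewrite rE /central; ext_eval.
rewrite /sep es es' cs cs' ex.
set c := absz (a + b).
have LxE : ell x = (absz a + absz b + c)%N by rewrite /ell; ext_eval; lia.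
have R (a1 a3 r0 r2 : int) (n : bool) :
    xi * a1%:~R + xi ^+ 3 * a3%:~R + n%:R * xi * (r0%:~R + xi ^+ 2 * r2%:~R) =
    xi * (a1 + n%:Z * r0)%:~R + xi ^+ 3 * (a3 + n%:Z * r2)%:~R.
  by rewrite !rmorphD !rmorphM /=; ring.
rewrite !R {R}.
have -> : zabs x = c by rewrite /zabs /x /= perm1.
have Lh : ((ell x)./2 = maxn (absz a) (maxn (absz b) c))%N by rewrite LxE /c; lia.
rewrite Lh.
have lL : ell (s0 * x)%g = (absz a + absz b + absz (a + b - 1)%R)%N.
  by rewrite lE /ell; ext_eval; lia.
have rL : ell (x * s0)%g = (absz a + absz b + absz (a + b + 1)%R)%N.
  by rewrite rE /ell; ext_eval; lia.
have lA : abs3 (s0 * x)%g = (absz b, absz a, absz (a + b - 1)%R).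
  by rewrite lE /abs3 /=; congr (_, _, _); lia.
have rA : abs3 (x * s0)%g = (absz a, absz b, absz (a + b + 1)%R).
  by rewrite rE /abs3 /=; congr (_, _, _); lia.
rewrite lA rA lL rL LxE.
(* For [c = 0] both third entries are 1, and the symmetry of [om1] and [om3] suffices. *)
have [c0|c0] := posnP c.
  have -> : absz (a + b - 1)%R = 1%N by move: c0; rewrite /c; lia.
  have -> : absz (a + b + 1)%R = 1%N by move: c0; rewrite /c; lia.
  by rewrite (om3C _ (absz b)) (om1C _ (absz b)).
have cab : [\/ c = absz a + absz b, absz a = absz b + c | absz b = absz a + c]%N.
  have : [|| c == absz a + absz b, absz a == absz b + c | absz b == absz a + c]%N by lia.
  by case/or3P => /eqP; [constructor 1 | constructor 2 | constructor 3].
have S1 := om1_step (absz a) (absz b) j0 c0.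
have S3 := om3_step j c0 cab.
case: (leP 0 (a + b)) => ab0.
  have -> : absz (a + b - 1)%R = c.-1 by lia.
  have -> : absz (a + b + 1)%R = c.+1 by lia.
  rewrite !ltn_add2l prednK // leqnn ltnNge leqnSn /= !mul1r !mul0r !addr0.
  by rewrite (om3C _ (absz b)) (om1C _ (absz b)) S1 S3.
have -> : absz (a + b - 1)%R = c.+1 by lia.
have -> : absz (a + b + 1)%R = c.-1 by lia.
rewrite !ltn_add2l prednK // leqnn ltnNge leqnSn /= !mul1r !mul0r !addr0.
by rewrite (om3C _ (absz b)) (om1C _ (absz b)) S1 S3.
Qed.

Lemma trace_rel_twist phi i x : (forall x, phi (twist x) = phi x) ->
  trace_rel phi (ordS i) (twist x) -> trace_rel phi i x.
Proof.
by move=> phiT; rewrite /trace_rel -twist_srefl -twist_delta_srefl !ell_twist !phiT.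
Qed.

(** For even [x], twisting reduces to translations, where only [s0] produces central products. *)
Lemma is_trace_sep j : (0 < j)%N -> is_trace (sep j).
Proof.
move=> j0; split=> [i x|]; last exact: sep_twist.
have [ex|ex] := boolP (even_fin x); last first.
  have [cx|cx] := boolP (central x); first exact: trace_rel_sep_central.
  exact: trace_rel_sep_nc.
have [n [a [b xE]]] := twist_trans ex.
elim: n x i ex xE => [|n IH] x i ex; last first.
  rewrite iterSr => /IH H; apply: trace_rel_twist; first exact: sep_twist.
  by apply: H; rewrite even_twist.
move=> /= ->.
elim/I3_cases: i.
- exact: trace_rel_sep_trans.
- apply: trace_rel_sep_even_nc => //; first by parity.
  by rewrite sreflE; ext_eval; rewrite /central; ext_eval.
- apply: trace_rel_sep_even_nc => //; first by parity.
  by rewrite sreflE; ext_eval; rewrite /central; ext_eval.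
Qed.

(** * From functions to delta-traces *)

(** Freeness in [is_basis] concerns duplicate-free lists; grouping equal indices makes it apply to
    any combination. *)
Lemma regroup (V : lmodType laurent) (I : eqType)
    (g : I -> V) (l : seq (laurent * I)) :
  \sum_(p <- l) p.1 *: g p.2 =
  \sum_(i <- undup [seq p.2 | p <- l]) (\sum_(p <- l | p.2 == i) p.1) *: g i.
Proof.
under [RHS]eq_bigr => i _ do rewrite scaler_suml.
rewrite (exchange_big_dep predT) //= !big_seq; apply: eq_bigr => p pl.
rewrite (big_rem p.2) /=; last by rewrite mem_undup; apply: map_f.
rewrite eqxx big1_seq ?addr0 // => i /andP[/eqP <-].
by rewrite mem_rem_uniq ?undup_uniq // inE eqxx.
Qed.

Section Hecke.

Context (H : algType laurent) (T : ext_weyl -> H) (dH : {linear H -> H}).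
Hypotheses (hT : is_hecke T) (hdH : forall x, dH (T x) = T (delta x)).

Definition comb (l : seq (laurent * ext_weyl)) : H := \sum_(p <- l) p.1 *: T p.2.

Lemma comb_surj x : exists l, x = comb l.
Proof.
have [[span _] _ _] := hT; have [s [c ->]] := span x.
by exists [seq (c i, i) | i <- s]; rewrite /comb big_map.
Qed.

Lemma comb_eq0 (phi : ext_weyl -> laurent) l : comb l = 0 ->
  \sum_(p <- l) p.1 * phi p.2 = 0.
Proof.
have [[_ free] _ _] := hT; rewrite /comb regroup => /free c0.
rewrite (@regroup laurent^o _ phi l) big1_seq // => i /andP[_ li].
by rewrite c0 ?scale0r ?undup_uniq.
Qed.

(** The linear extension of [phi], read off a chosen expansion; [lift_comb] shows that the choice is
    immaterial. *)
Definition lift (phi : ext_weyl -> laurent) (x : H) : laurent :=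
  \sum_(p <- sval (cid (comb_surj x))) p.1 * phi p.2.

Lemma lift_comb phi l : lift phi (comb l) = \sum_(p <- l) p.1 * phi p.2.
Proof.
rewrite /lift; case: cid => r /= rE.
have : comb (r ++ [seq (- p.1, p.2) | p <- l]) = 0.
  rewrite /comb big_cat big_map /=; under [X in _ + X]eq_bigr => p _ do rewrite scaleNr.
  by rewrite sumrN -!/(comb _) -rE subrr.
move=> /(comb_eq0 phi); rewrite big_cat big_map /=.
under [X in _ + X]eq_bigr => p _ do rewrite mulNr.
by rewrite sumrN => /eqP; rewrite subr_eq0 => /eqP.
Qed.

Lemma liftT phi x : lift phi (T x) = phi x.
Proof.
have -> : T x = comb [:: (1, x)] by rewrite /comb big_seq1 scale1r.
by rewrite lift_comb big_seq1 mul1r.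
Qed.

Lemma lift_is_linear phi : linear_for *%R (lift phi).
Proof.
move=> a x y; have [l ->] := comb_surj x; have [r ->] := comb_surj y.
have -> : a *: comb l + comb r = comb ([seq (a * p.1, p.2) | p <- l] ++ r).
  rewrite /comb big_cat big_map scaler_sumr; congr (_ + _).
  by apply: eq_bigr => p _; rewrite scalerA.
rewrite !lift_comb big_cat big_map mulr_sumr; congr (_ + _).
by apply: eq_bigr => p _; rewrite mulrA.
Qed.

HB.instance Definition _ phi :=
  GRing.isLinear.Build laurent H laurent *%R (lift phi) (lift_is_linear phi).

Lemma liftZ phi a x : lift phi (a *: x) = a * lift phi x.
Proof. exact: scalarZ. Qed.

Lemma ell_sreflE i : ell (srefl i) = 1%N.
Proof. by elim/I3_cases: i; rewrite sreflE; ext_eval; rewrite /ell; ext_eval. Qed.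

Lemma T_mul x y : (ell x + ell y = ell (x * y)%g)%N -> T x * T y = T (x * y)%g.
Proof. by have [_ TM _] := hT => Lxy; apply: TM; rewrite !lenE. Qed.

Lemma T_srefl2 i : T (srefl i) * T (srefl i) = xi *: T (srefl i) + 1.
Proof.
have [_ _ /(_ i)] := hT; rewrite mulrDr mulrBl !mulrBl.
rewrite -!scalerAl !mul1r -!scalerAr !mulr1 scalerA mulvV scale1r.
move=> /eqP; rewrite addrACA -opprD subr_eq0 => /eqP E.
by rewrite scalerBl addrAC -E addrK.
Qed.

Lemma T_srefl_mul i x : T (srefl i) * T x =
  T (srefl i * x)%g + ((ell (srefl i * x)%g < ell x)%N%:R * xi) *: T x.
Proof.
case: (ell_srefl i x) => Lx.
  by rewrite Lx ltnNge leqnSn mul0r scale0r addr0 T_mul // ell_sreflE.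
rewrite -Lx ltnSn mul1r.
have E : T (srefl i) * T (srefl i * x)%g = T x.
  by rewrite T_mul mulgA srefl2 mul1g // ell_sreflE.
by rewrite -{1}E mulrA T_srefl2 mulrDl mul1r -scalerAl E addrC.
Qed.

Lemma T_mul_srefl i x : T x * T (srefl i) =
  T (x * srefl i)%g + ((ell (x * srefl i)%g < ell x)%N%:R * xi) *: T x.
Proof.
case: (ell_mul_srefl i x) => Lx.
  by rewrite Lx ltnNge leqnSn mul0r scale0r addr0 T_mul // ell_sreflE addn1.
rewrite -Lx ltnSn mul1r.
have E : T (x * srefl i)%g * T (srefl i) = T x.
  by rewrite T_mul -mulgA srefl2 mulg1 // ell_sreflE addn1.
by rewrite -{1}E -mulrA T_srefl2 mulrDr mulr1 -scalerAr E addrC.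
Qed.

Lemma delta_srefl i : {k | delta (srefl i) = srefl k}.
Proof.
case: (eqVneq i i0) => [->|ne0]; first by exists i0; exact: delta_s0.
case: (eqVneq i i1) => [->|ne1]; first by exists i2; exact: delta_s1.
exists i1; rewrite (_ : i = i2) ?sreflE ?delta_s2 //.
by elim/I3_cases: i ne0 ne1.
Qed.

(** [T 1] fixes every [T x] from the left, hence also 1 expanded in the basis. *)
Lemma T1 : T 1%g = 1.
Proof.
rewrite -[LHS]mulr1; have [l ->] := comb_surj 1.
rewrite mulr_sumr; apply: eq_bigr => p _; rewrite -scalerAr T_mul ?mul1g //.
by have -> : ell 1%g = 0%N; rewrite // /ell; ext_eval.
Qed.

Section Trace.
Variable phi : ext_weyl -> laurent.
Hypothesis phi_trace : is_trace phi.

Definition good_elt x := forall h, lift phi (T x * h) = lift phi (h * T (delta x)).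

Lemma good_basis x :
  (forall y, lift phi (T x * T y) = lift phi (T y * T (delta x))) -> good_elt x.
Proof.
move=> E h; have [l ->] := comb_surj h; rewrite mulr_sumr mulr_suml !raddf_sum.
by apply: eq_bigr => p _; rewrite -scalerAr -scalerAl /= !liftZ E.
Qed.

Lemma good_srefl i : good_elt (srefl i).
Proof.
apply: good_basis => y; have [k kE] := delta_srefl i.
have [/(_ i y)] := phi_trace; rewrite /trace_rel kE => E _.
by rewrite T_srefl_mul T_mul_srefl !linearD /= !liftZ !liftT.
Qed.

Lemma good_tau : good_elt tau.
Proof.
apply: good_basis => y; have [_ /(_ (y * tau^-1)%g)] := phi_trace.
rewrite delta_tau /twist => E.
have E0 : (tau * (y * tau^-1) * tau = tau * y)%g.
  by move: tau => z; rewrite -mulgA mulgVK.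
have Lt : ell tau = 0%N by rewrite -(mulg1 tau) ell_tau /ell; ext_eval.
rewrite !T_mul.
- by rewrite !liftT -E E0.
- by rewrite ell_inv Lt addn0 -[in RHS]ell_mul_tau -mulgA mulVg mulg1.
- by rewrite ell_tau Lt.
Qed.

(** The factors are moved to the right one after the other; [delta] preserves lengths, so their
    images recombine. *)
Lemma good_mul x y : (ell x + ell y = ell (x * y)%g)%N ->
  good_elt x -> good_elt y -> good_elt (x * y)%g.
Proof.
move=> Lxy gx gy h; rewrite -T_mul // -mulrA gx -mulrA gy -mulrA T_mul ?deltaM //.
by rewrite -deltaM !ell_delta.
Qed.

Lemma good_all x : good_elt x.
Proof.
move Ln: (ell x) => n; elim: n x Ln => [|n IH] x Ln.
  have [j ->] := ell_eq0 Ln; elim: j {x Ln} => [|j IH].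
    by move=> h; rewrite expg0 delta1 T1 mulr1 mul1r.
  rewrite expgS; apply: good_mul => //; last exact: good_tau.
  by rewrite ell_tau -[in X in (X + _)%N](mulg1 tau) ell_tau /ell; ext_eval.
have [i Li] : exists i, (ell (srefl i * x)%g).+1 = ell x by apply: ell_neq0P; rewrite Ln.
have -> : x = (srefl i * (srefl i * x))%g by rewrite mulgA srefl2 mul1g.
apply: good_mul; last by apply: IH; rewrite -Li in Ln; case: Ln.
- by rewrite ell_sreflE mulgA srefl2 mul1g.
- exact: good_srefl.
Qed.

Lemma lift_mulC x y : lift phi (x * y) = lift phi (y * dH x).
Proof.
have [l ->] := comb_surj x; rewrite /comb raddf_sum mulr_suml mulr_sumr !raddf_sum.
apply: eq_bigr => p _ /=.
by rewrite linearZ /= hdH -scalerAl -scalerAr !liftZ good_all.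
Qed.

Lemma lift_cocomm x : cocomm dH x -> lift phi x = 0.
Proof.
case=> s ->; rewrite raddf_sum big1 // => p _ /=.
by rewrite liftZ raddfB /= lift_mulC subrr mulr0.
Qed.

End Trace.
End Hecke.

(** * Reduction to minimal length modulo [H, H]_delta *)

Lemma twist_r1 (a b : int) : twist (Ext (a, b) r1) = Ext (1 - a - b, a - 1) r1.
Proof.
rewrite /twist; ext_eval; congr Ext; first by congr pair => /=; lia.
by apply: permI3; rewrite !permM !tperm_val.
Qed.

Lemma delta_ext_r2 (a b : int) : delta (Ext (a, b) r2) = Ext (b, a) r1.
Proof. by rewrite /delta /= conj_r2. Qed.

Lemma s0_conj_t (a b : int) : (s0 * t (a, b) * delta s0)%g = t (- b, - a).
Proof.
rewrite delta_s0 /t; ext_eval; congr Ext; first by congr pair => /=; lia.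
by apply: permI3; rewrite ?(permM, tperm_val, perm1).
Qed.

Lemma s1_conj_t (a b : int) :
  twist (s1 * t (a, b) * delta s1)%g = t (1 - b, - a - 1).
Proof.
rewrite delta_s1 /twist /t; ext_eval; congr Ext; first by congr pair => /=; lia.
by apply: permI3; rewrite ?(permM, tperm_val, perm1).
Qed.

Lemma ell_t (a b : int) : ell (t (a, b)) = (absz a + absz b + absz (a + b)%R)%N.
Proof. by rewrite /ell /t; ext_eval; lia. Qed.

Section Cocenter.

Context (H : algType laurent) (T : ext_weyl -> H) (dH : {linear H -> H}).
Hypotheses (hT : is_hecke T) (hdH : forall x, dH (T x) = T (delta x)).

Lemma cocommB x y : cocomm dH (x * y - y * dH x).
Proof. by exists [:: (1, (x, y))]; rewrite big_seq1 scale1r. Qed.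

Lemma cocommD x y : cocomm dH x -> cocomm dH y -> cocomm dH (x + y).
Proof. by case=> s -> [r ->]; exists (s ++ r); rewrite big_cat. Qed.

Lemma cocommZ a x : cocomm dH x -> cocomm dH (a *: x).
Proof.
case=> s ->; exists [seq (a * p.1, p.2) | p <- s].
by rewrite big_map scaler_sumr; apply: eq_bigr => p _; rewrite scalerA.
Qed.

Definition eqc (x y : H) := cocomm dH (x - y).

Lemma eqc_refl x : eqc x x.
Proof. by exists [::]; rewrite big_nil subrr. Qed.

Lemma eqc_sym x y : eqc x y -> eqc y x.
Proof. by move=> /(cocommZ (-1)); rewrite scaleN1r opprB. Qed.

Lemma eqc_trans y x z : eqc x y -> eqc y z -> eqc x z.
Proof. by move=> xy /(cocommD xy); rewrite addrA subrK. Qed.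

Lemma eqcD x y z w : eqc x y -> eqc z w -> eqc (x + z) (y + w).
Proof. by move=> xy /(cocommD xy); rewrite addrACA -opprD. Qed.

Lemma eqcZ a x y : eqc x y -> eqc (a *: x) (a *: y).
Proof. by move=> /(cocommZ a); rewrite scalerBr. Qed.

Lemma eqc_sum (I : Type) (r : seq I) (P : pred I) (F G : I -> H) :
  (forall i, P i -> eqc (F i) (G i)) ->
  eqc (\sum_(i <- r | P i) F i) (\sum_(i <- r | P i) G i).
Proof. by move=> FG; elim/big_ind2: _ => // *; [exact: eqc_refl | exact: eqcD]. Qed.

Lemma eqc_T_srefl i x : eqc
  (T (srefl i * x)%g + ((ell (srefl i * x)%g < ell x)%N%:R * xi) *: T x)
  (T (x * delta (srefl i))%g + ((ell (x * delta (srefl i))%g < ell x)%N%:R * xi) *: T x).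
Proof.
have [k kE] := delta_srefl i.
by rewrite kE -(T_srefl_mul hT) -(T_mul_srefl hT) -kE -hdH; exact: cocommB.
Qed.

(** In the relation for [srefl i * x] the two correction terms are equal and cancel. *)
Lemma eqc_conj i x : ell (srefl i * x * delta (srefl i))%g = ell x ->
  eqc (T x) (T (srefl i * x * delta (srefl i))%g).
Proof.
move=> Lx; have := eqc_T_srefl i (srefl i * x)%g.
rewrite mulgA srefl2 mul1g Lx => E.
by have := cocommD E (eqc_refl 0); rewrite subrr addr0 opprD addrACA subrr addr0.
Qed.

Lemma eqc_conj_lt i x : (ell (srefl i * x * delta (srefl i))%g < ell x)%N ->
  eqc (T x) (T (srefl i * x * delta (srefl i))%g + xi *: T (srefl i * x)%g).
Proof.
move=> Lx; have := eqc_T_srefl i (srefl i * x)%g; rewrite mulgA srefl2 mul1g.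
have Ls := ell_srefl i x; have Lt := ell_mul_delta_srefl i (srefl i * x)%g.
move: Lx Ls Lt; set y := ell (srefl i * x)%g; set z := ell (srefl i * x * _)%g.
move=> Lx Ls Lt; have [-> ->] : (ell x < y)%N = false /\ (z < y)%N by lia.
by rewrite mul0r scale0r addr0 mul1r.
Qed.

Lemma eqc_twist x : eqc (T (twist x)) (T x).
Proof.
have Lt : ell tau = 0%N by rewrite -(mulg1 tau) ell_tau /ell; ext_eval.
have := cocommB (T tau) (T (x * tau)%g); rewrite hdH delta_tau !(T_mul hT).
- by rewrite /eqc /twist; move: tau => z; rewrite mulgA mulgK.
- by rewrite ell_mul_tau ell_inv Lt addn0 mulgK.
- by rewrite ell_tau Lt.
Qed.

Lemma eqc_iter_twist n x : eqc (T (iter n twist x)) (T x).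
Proof.
elim: n => [|n IH]; first exact: eqc_refl.
exact: eqc_trans (eqc_twist _) IH.
Qed.

(** This is the twisted commutator of [T x] with 1. *)
Lemma eqc_delta x : eqc (T (delta x)) (T x).
Proof. by apply: eqc_sym; have := cocommB (T x) 1; rewrite mulr1 mul1r hdH. Qed.

Lemma eqc_t_opp (a b : int) : eqc (T (t (a, b))) (T (t (- b, - a))).
Proof.
by rewrite -s0_conj_t; apply: (eqc_conj (i := i0)); rewrite sreflE s0_conj_t !ell_t; lia.
Qed.

(** Conjugation by [s1] and [twist] lead to [t (1 - b, - a - 1)] without changing the length;
    [eqc_t_opp] reverses the signs. *)
Lemma eqc_t_step (a b : int) : 0 <= a -> 1 <= b ->
  eqc (T (t (a, b))) (T (t (a + 1, b - 1))).
Proof.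
move=> a0 b0; apply: (@eqc_trans (T (s1 * t (a, b) * delta s1)%g)).
  by apply: (eqc_conj (i := i1)); rewrite -ell_twist sreflE s1_conj_t !ell_t; lia.
apply: eqc_trans (eqc_sym (eqc_twist _)) _; rewrite s1_conj_t.
by have := eqc_t_opp (1 - b) (- a - 1); rewrite !opprB opprK [1 + a]addrC.
Qed.

Lemma eqc_t_ge0 (a : int) (n : nat) : 0 <= a ->
  eqc (T (t (a, n%:Z))) (T (t (a + n%:Z, 0))).
Proof.
elim: n a => [|n IH] a a0; first by rewrite addr0; exact: eqc_refl.
apply: eqc_trans (eqc_t_step a0 _) _ => //.
have -> : n.+1%:Z - 1 = n%:Z by lia.
have -> : a + n.+1%:Z = a + 1 + n%:Z by lia.
by apply: IH; lia.
Qed.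

(** After twisting to [t (a, b)], the length condition says that [a] and [b] do not have opposite
    signs; unit steps then collect them in one coordinate. *)
Lemma eqc_min_even (x : ext_weyl) : even_fin x -> ell x = (zabs x).*2 ->
  eqc (T x) (T (t ((zabs x)%:Z, 0))).
Proof.
move=> ex; have [n [a [b xE]]] := twist_trans ex.
elim: n x ex xE => [|n IH] x ex; last first.
  rewrite iterSr => /IH; rewrite even_twist ell_twist zabs_twist // => E /E {}E.
  by apply: eqc_trans (eqc_sym (eqc_twist _)) _; apply: E.
move=> /= ->; rewrite ell_t /zabs /= perm1 /= => Lab.
have [/andP[a0 b0]|ab0] := boolP ((0 <= a) && (0 <= b)).
  have -> : b = (absz b)%:Z by lia.
  have -> : (absz (a + (absz b)%:Z))%:Z = a + (absz b)%:Z by lia.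
  exact: eqc_t_ge0.
apply: eqc_trans (eqc_t_opp _ _) _.
have -> : - a = (absz a)%:Z by lia.
have -> : (absz (a + b))%:Z = - b + (absz a)%:Z by lia.
by apply: eqc_t_ge0; lia.
Qed.

(** The expected expansion: [Ext (1, 0) r1] has length 1, and [t (j, 0)] has minimal length in
    O_2j. *)
Definition O1_sum (k : nat) : H :=
  T (Ext (1, 0) r1) + xi *: \sum_(0 <= i < k) T (t (i.+1%:Z, 0)).

(* [twist] permutes cyclically the three numbers a - 1, b, -(a + b); as their
   sum is -1, exactly two of them are on the same side of [-1/2], and these can
   be brought to the first two places. *)
Lemma rotate_r1 (a b : int) : exists n (c d : int),
  iter n twist (Ext (a, b) r1) = Ext (c, d) r1 /\
  (1 <= c /\ 0 <= d \/ c <= 0 /\ d < 0).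
Proof.
have [H0|] := boolP ((1 <= a) && (0 <= b) || (a <= 0) && (b < 0)).
  by exists 0%N, a, b; split=> //; lia.
have [H1|H1 H0] := boolP
    ((1 <= 1 - a - b) && (0 <= a - 1) || (1 - a - b <= 0) && (a - 1 < 0)).
  by exists 1%N, (1 - a - b), (a - 1); rewrite /= twist_r1; split=> //; lia.
exists 2%N, (1 - (1 - a - b) - (a - 1)), (1 - a - b - 1).
by rewrite /= !twist_r1; split=> //; lia.
Qed.

(** [srefl i * x] has minimal length in O_2(k+1) and contributes the new last term of the sum. *)
Lemma O1_sum_conj i x k : ~~ even_fin x -> ell x = k.*2.+3 ->
  ell (srefl i * x * delta (srefl i))%g = k.*2.+1 ->
  zabs (srefl i * x)%g = k.+1 -> ell (srefl i * x)%g = k.+1.*2 ->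
  eqc (T (srefl i * x * delta (srefl i))%g) (O1_sum k) -> eqc (T x) (O1_sum k.+1).
Proof.
move=> ex Lx Ly zx Lsx E.
apply: eqc_trans (eqc_conj_lt (i := i) _) _; first by rewrite Ly Lx.
rewrite /O1_sum big_nat_recr //= scalerDr addrA; apply: eqcD => //.
apply: eqcZ; rewrite -zx; apply: eqc_min_even; last by rewrite zx.
by rewrite even_finM even_srefl (negbTE ex).
Qed.

Lemma ell_r1 (a b : int) :
  ell (Ext (a, b) r1) = (absz (a - 1)%R + absz b + absz (a + b)%R)%N.
Proof. by rewrite /ell; ext_eval; lia. Qed.

Lemma eqc_r2 k (a b : int) : eqc (T (Ext (b, a) r1)) (O1_sum k) ->
  eqc (T (Ext (a, b) r2)) (O1_sum k).
Proof. by apply: eqc_trans; rewrite -delta_ext_r2; exact/eqc_sym/eqc_delta. Qed.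

Lemma eqc_r1_iter k n (a b : int) :
  eqc (T (iter n twist (Ext (a, b) r1))) (O1_sum k) -> eqc (T (Ext (a, b) r1)) (O1_sum k).
Proof. by apply: eqc_trans; exact/eqc_sym/eqc_iter_twist. Qed.

(** Here [a + b = - (k + 1)], and conjugation by [s2] lowers the length by 2; [delta] brings the
    result back to finite part [r1]. *)
Lemma eqc_r1_neg k (a b : int) : a <= 0 -> b < 0 ->
  (forall c d : int, ell (Ext (c, d) r1) = k.*2.+1 -> eqc (T (Ext (c, d) r1)) (O1_sum k)) ->
  ell (Ext (a, b) r1) = k.*2.+3 -> eqc (T (Ext (a, b) r1)) (O1_sum k.+1).
Proof.
move=> a0 b0 IH Lx.
have lE : (srefl i2 * Ext (a, b) r1)%g = Ext (a + b, - b) (r2 * r1).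
  by rewrite sreflE; ext_eval; congr Ext; congr pair => /=; lia.
have rE : (srefl i2 * Ext (a, b) r1 * delta (srefl i2))%g = Ext (a + b, - b) r2.
  rewrite lE sreflE delta_s2; ext_eval; congr Ext; first by congr pair => /=; lia.
  by apply: permI3; rewrite ?(permM, tperm_val, perm1).
move: (Lx); rewrite ell_r1 => Lab.
apply: (O1_sum_conj (i := i2)); first by parity.
- by rewrite Lx.
- by rewrite rE /ell; ext_eval; lia.
- by rewrite lE /zabs; ext_eval; lia.
- by rewrite lE /ell; ext_eval; lia.
- by rewrite rE; apply/eqc_r2/IH; rewrite ell_r1; lia.
Qed.

Lemma eqc_r1 k (a b : int) : ell (Ext (a, b) r1) = k.*2.+1 ->
  eqc (T (Ext (a, b) r1)) (O1_sum k).
Proof.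
elim: k a b => [|k IH] a b.
  have [n [c [d [E cd]]]] := rotate_r1 a b.
  have <- : ell (iter n twist (Ext (a, b) r1)) = ell (Ext (a, b) r1).
    by elim: n {E} => //= n <-; rewrite ell_twist.
  rewrite E ell_r1 => Lcd; apply: (eqc_r1_iter (n := n)); rewrite E.
  have -> : c = 1 by lia.
  have -> : d = 0 by lia.
  by rewrite /O1_sum big_geq // scaler0 addr0; exact: eqc_refl.
have [n [c [d [E cd]]]] := rotate_r1 a b.
have <- : ell (iter n twist (Ext (a, b) r1)) = ell (Ext (a, b) r1).
  by elim: n {E} => //= n <-; rewrite ell_twist.
rewrite E doubleS => Lcd; apply: (eqc_r1_iter (n := n)); rewrite E.
case: cd => -[c0 d0]; last exact: eqc_r1_neg.
move: (Lcd); rewrite ell_r1 => LE.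
(* A length-preserving conjugation, by [s1] if [d > 0] and by [s0] if [d = 0], followed by [delta]
   and, for [s1], two twists, reaches the case of [eqc_r1_neg]. *)
have [d1|d1] := ltP 0 d.
  have rE : (srefl i1 * Ext (c, d) r1 * delta (srefl i1))%g = Ext (- c, c + d) r2.
    rewrite sreflE delta_s1; ext_eval; congr Ext; first by congr pair => /=; lia.
    by apply: permI3; rewrite ?(permM, tperm_val, perm1).
  apply: eqc_trans (eqc_conj (i := i1) _) _; first by rewrite rE Lcd /ell; ext_eval; lia.
  rewrite rE; apply: eqc_r2; apply: (eqc_r1_iter (n := 2)).
  rewrite /= !twist_r1; apply: eqc_r1_neg => //; first by lia.
  - by lia.
  - by rewrite ell_r1; lia.
(* Now [d = 0], and the length forces [c = k + 2], so that [2 - c <= 0]. *)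
have rE : (srefl i0 * Ext (c, d) r1 * delta (srefl i0))%g = Ext (- d - 1, 2 - c) r2.
  rewrite sreflE delta_s0; ext_eval; congr Ext; first by congr pair => /=; lia.
  by apply: permI3; rewrite ?(permM, tperm_val, perm1).
apply: eqc_trans (eqc_conj (i := i0) _) _; first by rewrite rE Lcd /ell; ext_eval; lia.
rewrite rE; apply: eqc_r2; apply: eqc_r1_neg => //; first by lia.
- by lia.
- by rewrite ell_r1; lia.
Qed.

Lemma eqc_O1 k x : ~~ even_fin x -> ~~ central x -> ell x = k.*2.+1 ->
  eqc (T x) (O1_sum k).
Proof.
ext_cases x; parity => _; rewrite /central; ext_eval; rewrite ?i_neq ?eqxx // => _.
- exact: eqc_r1.
- move=> Lx; apply/eqc_r2/eqc_r1; rewrite -Lx.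
  by rewrite -[in LHS](delta_ext_r2) ell_delta.
Qed.

End Cocenter.

(** * The delta-conjugacy classes *)

(** The simple reflections and [tau] generate the group, and delta-conjugation by [tau] is
    [twist]. *)
Lemma conj_ind (P : ext_weyl -> Prop) x :
  (forall i y, P y -> P (srefl i * y * delta (srefl i))%g) ->
  (forall y, P y -> P (twist y)) -> P x ->
  forall z, P (z * x * (delta z)^-1)%g.
Proof.
move=> Ps PT Px [l u]; have [n [w [j ->]]] := expr_trans l u.
have step y z : (y * z * x * (delta (y * z)%g)^-1 =
    y * (z * x * (delta z)^-1) * (delta y)^-1)%g.
  by rewrite deltaM invgM !mulgA.
elim: (tval w) => [|i r IH].
  rewrite big_nil mul1g; elim: j => [|j IH].
    by rewrite expg0 delta1 invg1 mulg1 mul1g.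
  by rewrite expgS step delta_tau invgK; apply: PT.
by rewrite big_cons -(mulgA (srefl i)) step delta_sreflV; apply: Ps.
Qed.

Lemma zabs_delta_conj x z : even_fin x ->
  even_fin (z * x * (delta z)^-1)%g /\ zabs (z * x * (delta z)^-1)%g = zabs x.
Proof.
move=> ex; move: z.
apply: (@conj_ind (fun y => even_fin y /\ zabs y = zabs x)) => //
  [i y [ey <-]|y [ey <-]].
  have es : even_fin (srefl i * y)%g = false by rewrite even_finM even_srefl ey.
  split; first by rewrite even_finM even_delta even_srefl es.
  by rewrite -zabs_conj ?es // mulgA srefl2 mul1g.
by rewrite even_twist zabs_twist.
Qed.

Lemma central_delta_conj x z : ~~ even_fin x ->
  ~~ even_fin (z * x * (delta z)^-1)%g /\ central (z * x * (delta z)^-1)%g = central x.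
Proof.
move=> ex; move: z.
apply: (@conj_ind (fun y => ~~ even_fin y /\ central y = central x)) => //
  [i y [ey <-]|y [ey <-]].
  have es : even_fin (srefl i * y)%g by rewrite even_finM even_srefl (negbTE ey).
  split; first by rewrite even_finM even_delta even_srefl es.
  by rewrite -central_conj // mulgA srefl2 mul1g.
by rewrite even_twist central_twist.
Qed.

Lemma delta_class_refl x : delta_class x x.
Proof. by exists 1%g; rewrite delta1 invg1 mulg1 mul1g. Qed.

Lemma delta_class_trans y x z : delta_class x y -> delta_class y z -> delta_class x z.
Proof.
by move=> [a ->] [b ->]; exists (b * a)%g; rewrite deltaM invgM !mulgA.
Qed.

Lemma delta_inv x : delta x^-1%g = (delta x)^-1%g.
Proof. by apply: (mulIg (delta x)); rewrite mulVg -deltaM mulVg delta1. Qed.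

Lemma delta_class_sym x y : delta_class x y -> delta_class y x.
Proof.
move=> [a ->]; exists a^-1%g.
by rewrite delta_inv invgK -!mulgA mulVg mulg1 mulKg.
Qed.

Lemma delta_class_eq x y : delta_class x y -> delta_class x = delta_class y.
Proof.
move=> xy; apply/seteqP; split=> z; apply: delta_class_trans => //.
exact: delta_class_sym.
Qed.

Lemma delta_class_delta x : delta_class x (delta x).
Proof. by exists x^-1%g; rewrite delta_inv invgK mulVg mul1g. Qed.

Lemma delta_class_twist x : delta_class x (twist x).
Proof. by exists tau; rewrite delta_tau invgK. Qed.

Lemma delta_class_iter_twist n x : delta_class x (iter n twist x).
Proof.
elim: n => [|n IH]; first exact: delta_class_refl.
exact: delta_class_trans IH (delta_class_twist _).
Qed.

Lemma delta_class_srefl i x : delta_class x (srefl i * x * delta (srefl i))%g.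
Proof. by exists (srefl i); rewrite delta_sreflV. Qed.

Lemma tinv (a b : int) : ((t (a, b))^-1 = t (- a, - b))%g.
Proof. by rewrite -tV. Qed.

Lemma delta_class_s1 (a b : int) : delta_class s1 (Ext (a, b) r1).
Proof.
(* Delta-conjugating [s1] by [t (p, q)] gives [Ext (p + q, - p) r1]; this is solved for [p] and
   [q]. *)
exists (t (- b, a + b)); rewrite delta_t tinv /t; ext_eval.
rewrite mul1g mulg1; congr Ext; congr pair => /=; lia.
Qed.

Lemma delta_ext_r1 (a b : int) : delta (Ext (a, b) r1) = Ext (b, a) r2.
Proof. by rewrite /delta /= conj_r1. Qed.

Lemma delta_class_s1E x : delta_class s1 x <-> ~~ even_fin x /\ ~~ central x.
Proof.
split=> [[z ->]|[]].
  have e1 : ~~ even_fin s1 by rewrite (even_srefl i1).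
  by have [-> ->] := central_delta_conj z e1; rewrite /central; ext_eval; rewrite ?i_neq.
ext_cases x; parity => _; rewrite /central; ext_eval; rewrite ?i_neq ?eqxx // => _.
  exact: delta_class_s1.
rewrite -delta_ext_r1.
exact: delta_class_trans (delta_class_s1 _ _) (delta_class_delta _).
Qed.

Lemma delta_class_t_shift (a b : int) : delta_class (t (a, b)) (t (a + b, 0)).
Proof.
exists (t (b, 0)); rewrite delta_t tinv /t; ext_eval.
rewrite !mul1g; congr Ext; congr pair => /=; lia.
Qed.

Lemma delta_class_tE (m : nat) x :
  delta_class (t (m%:Z, 0)) x <-> even_fin x /\ zabs x = m.
Proof.
split=> [[z ->]|[ex <-]].
  have e1 : even_fin (t (m%:Z, 0)) by parity.
  by have [-> ->] := zabs_delta_conj z e1; rewrite /zabs /= perm1 /=; split=> //; lia.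
have [n [a [b xE]]] := twist_trans ex.
have xab : delta_class x (t (a, b)) by rewrite -xE; exact: delta_class_iter_twist.
have -> : zabs x = absz (a + b).
  have [z tE] := xab; have [_] := zabs_delta_conj z ex.
  by rewrite -tE /zabs /= perm1.
apply: delta_class_sym; apply: delta_class_trans xab _.
have [ab0|ab0] := leP 0 (a + b).
  have -> : (absz (a + b))%:Z = a + b by lia.
  exact: delta_class_t_shift.
have -> : (absz (a + b))%:Z = - b + - a by lia.
apply: (@delta_class_trans (t (- b, - a))); last exact: delta_class_t_shift.
rewrite -s0_conj_t; exact: (delta_class_srefl i0).
Qed.

(** * Comparison with the explicit sets O_1 and O_2m *)

Lemma twist3 x : twist (twist (twist x)) = x.
Proof.
have := tau3; rewrite !expgS expg0 mulg1 /twist; move: tau => y y3.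
by rewrite !mulgA -(mulgA y y y) y3 mul1g -!mulgA y3 mulg1.
Qed.

(** The two added pieces are the images of [X] under [twist] and its square, and [twist] has order
    3. *)
Lemma hatE X x : hat X x <-> [\/ X x, X (twist x) | X (twist (twist x))].
Proof.
have E1 y : (tau * y * tau^-1 * tau ^+ 2)%g = twist y.
  by rewrite /twist expgS expg1; move: tau => z; rewrite !mulgA mulgVK.
have E2 y : (tau ^+ 2 * y * (tau ^+ 2)^-1 * tau)%g = twist (twist y).
  have T2 : ((tau ^+ 2)^-1 = tau)%g.
    apply: (mulIg (tau ^+ 2)%g); rewrite mulVg -expgS; exact/esym/tau3.
  by rewrite T2 /twist expgS expg1; move: tau => z; rewrite !mulgA.
split=> [[[Xx|[y Xy <-]]|[y Xy <-]]|[Xx|Xx|Xx]].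
- exact: Or31.
- by apply: Or33; rewrite E1 twist3.
- by apply: Or32; rewrite E2 twist3.
- by left; left.
- by right; exists (twist x) => //; rewrite E2 twist3.
- by left; right; exists (twist (twist x)) => //; rewrite E1 twist3.
Qed.

(** The class of [x] in P/Q, a group of order 3. *)
Definition mod3 (x : coweight) : int := ((2 * x.1 + x.2) %% 3)%Z.

Lemma root_latticeP x : mod3 x = 0 -> root_lattice x.
Proof.
case: x => a b; rewrite /mod3 /= => ab.
exists ((2 * a + b) %/ 3)%Z, (2 * ((2 * a + b) %/ 3)%Z - a).
by rewrite /alpha1 /alpha2 !coweight_mulz; congr pair => /=; lia.
Qed.

Lemma mod3_twist x :
  mod3 (trans_part (twist x)) = ((mod3 (trans_part x) + 1) %% 3)%Z.
Proof. by ext_cases x; rewrite /twist; ext_eval; rewrite /mod3 /=; lia. Qed.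

Lemma trans_twist_lattice x : [\/ root_lattice (trans_part x),
  root_lattice (trans_part (twist x)) | root_lattice (trans_part (twist (twist x)))].
Proof.
have [H0|H0] := eqVneq (mod3 (trans_part x)) 0; first by apply/Or31/root_latticeP.
have [H1|H1] := eqVneq (mod3 (trans_part (twist x))) 0.
  by apply/Or32/root_latticeP.
apply/Or33/root_latticeP; move: H0 H1; rewrite !mod3_twist /mod3; lia.
Qed.

(** A class is stable under [twist], and each orbit of [twist] contains an element whose translation
    part is in Q. *)
Lemma hat_delta_class c X : X `<=` delta_class c ->
  (forall y, delta_class c y -> root_lattice (trans_part y) -> X y) ->
  hat X = delta_class c.
Proof.
have H x : delta_class c (twist x) <-> delta_class c x.
  split=> cx; apply: delta_class_trans cx _; last exact: delta_class_twist.
  by apply: delta_class_sym; exact: delta_class_twist.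
move=> Xc cX; apply/seteqP; split=> x.
  by case/hatE => /Xc; rewrite ?H.
move=> cx; apply/hatE; case: (trans_twist_lattice x) => l.
- by apply/Or31/cX.
- by apply/Or32/cX => //; rewrite H.
- by apply/Or33/cX => //; rewrite !H.
Qed.

Lemma O1E : O1 = delta_class s1.
Proof.
apply: hat_delta_class => [x [y _ [->|->]]|x].
- apply/delta_class_s1E; rewrite /t; ext_eval; rewrite /central; parity; ext_eval.
  by rewrite ?i_neq.
- apply/delta_class_s1E; rewrite /t; ext_eval; rewrite /central; parity; ext_eval.
  by rewrite ?i_neq.
case: x => l u /delta_class_s1E [] /= e1 c1 lQ; exists l => //; rewrite /t; ext_eval.
rewrite addr0 !mul1g; elim/S3_ind: u e1 c1; parity; rewrite /central; ext_eval;
  rewrite ?eqxx //; by [left | right].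
Qed.

Lemma tQE (a b : int) : tQ a b = Ext (2 * a - b, 2 * b - a) 1.
Proof.
by rewrite /tQ /t /alpha1 /alpha2 !coweight_mulz; congr Ext; congr pair => /=; lia.
Qed.

Lemma tQ_s1s2 (a b : int) :
  (tQ a b * s1 * s2)%g = Ext (2 * a - b, 2 * b - a) (r1 * r2).
Proof.
by rewrite tQE; ext_eval; rewrite mul1g; congr Ext; congr pair => /=; lia.
Qed.

Lemma tQ_s2s1 (a b : int) :
  (tQ a b * s2 * s1)%g = Ext (2 * a - b, 2 * b - a) (r2 * r1).
Proof.
by rewrite tQE; ext_eval; rewrite mul1g; congr Ext; congr pair => /=; lia.
Qed.

Lemma OevenE m : (0 < m)%N -> Oeven m = delta_class (t (m%:Z, 0)).
Proof.
move=> m0; rewrite /Oeven; set X := [set x | _].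
have X1 k : X (tQ (k - m./2%:Z) (2 * k + (odd m)%:Z) * s2 * s1)%g.
  by exists k; rewrite !inE eqxx.
have X2 k : X (tQ (k + m.+1./2%:Z) (2 * k + (odd m)%:Z) * s2 * s1)%g.
  by exists k; rewrite !inE eqxx ?orbT.
have X3 k : X (tQ (2 * k + (odd m)%:Z) (k + m.+1./2%:Z) * s1 * s2)%g.
  by exists k; rewrite !inE eqxx ?orbT.
have X4 k : X (tQ (2 * k + (odd m)%:Z) (k - m./2%:Z) * s1 * s2)%g.
  by exists k; rewrite !inE eqxx ?orbT.
have X5 k : X (tQ k (m%:Z - k)) by exists k; rewrite !inE eqxx ?orbT.
have X6 k : X (tQ (k - m%:Z) (- k)) by exists k; rewrite !inE eqxx ?orbT.
apply: hat_delta_class => [x [k]|x].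
  rewrite !inE !tQ_s1s2 !tQ_s2s1 !tQE => xk; apply/delta_class_tE.
  case/or4P: xk => [/eqP->|/eqP->|/eqP->|/or3P[]/eqP->]; (split; first by parity);
    by rewrite /zabs; ext_eval; lia.
move: X1 X2 X3 X4 X5 X6; move: X => X X1 X2 X3 X4 X5 X6.
case: x => l u /delta_class_tE [e1 z1] [p [q /= lE]].
move: e1 z1; rewrite {l}lE /alpha1 /alpha2 !coweight_mulz.
have -> : ((2 * p, -1 * p) : coweight) + (-1 * q, 2 * q) = (2 * p - q, 2 * q - p).
  by congr pair => /=; lia.
elim/S3_ind: u; parity => _; rewrite /zabs; ext_eval => z1.
(* For each rotation part, [zabs x = m] fixes a linear form in [p], [q] up to sign; the two signs
   correspond to two families, and solving for the parameter gives the witness. *)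
- have [pq|pq] := leP 0 (p + q); [have := X5 p | have := X6 (p + m%:Z)];
    by rewrite tQE; congr (X (Ext _ _)); congr pair; lia.
- have [pq|pq] := leP p (2 * q); [have := X3 (q - m.+1./2%:Z) | have := X4 (q + m./2%:Z)];
    by rewrite tQ_s1s2; congr (X (Ext _ _)); congr pair; lia.
- have [pq|pq] := leP q (2 * p); [have := X2 (p - m.+1./2%:Z) | have := X1 (p + m./2%:Z)];
    by rewrite tQ_s2s1; congr (X (Ext _ _)); congr pair; lia.
Qed.

Lemma Oeven_class m : (0 < m)%N -> delta_classes (Oeven m).
Proof. by move=> m0; rewrite OevenE //; exists (t (m%:Z, 0)). Qed.

Lemma O1_class : delta_classes O1.
Proof. by rewrite O1E; exists s1. Qed.

Lemma class_eq O O' x : delta_classes O -> delta_classes O' -> O x -> O' x -> O = O'.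
Proof.
move=> [a _ <-] [b _ <-] ax bx.
by rewrite (delta_class_eq ax) (delta_class_eq bx).
Qed.

Lemma Oeven_inj m n : (0 < m)%N -> (0 < n)%N -> Oeven m = Oeven n -> m = n.
Proof.
move=> m0 n0; rewrite !OevenE // => E.
have : delta_class (t (n%:Z, 0)) (t (m%:Z, 0)) by rewrite -E; exact: delta_class_refl.
by case/delta_class_tE => _; rewrite /zabs /= perm1 /= => <-; lia.
Qed.

Lemma Oeven_neq_O1 m : (0 < m)%N -> Oeven m <> O1.
Proof.
move=> m0; rewrite OevenE // O1E => E.
have : delta_class s1 (t (m%:Z, 0)) by rewrite -E; exact: delta_class_refl.
by case/delta_class_s1E; parity.
Qed.

(** * Minimal length elements and the list of classes *)

Lemma min_length_exists O : delta_classes O -> exists x, min_length O x.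
Proof.
move=> [a _ <-].
have ex : exists n, `[< exists2 x, delta_class a x & len x = n >].
  by exists (len a); apply/asboolP; exists a => //; exact: delta_class_refl.
case: (ex_minnP ex) => n /asboolP[x ax xn] n_min; exists x; split=> // y ay.
by rewrite xn; apply: n_min; apply/asboolP; exists y.
Qed.

Lemma min_length_O1 x :
  min_length O1 x -> [/\ ~~ even_fin x, ~~ central x & ell x = 1%N].
Proof.
rewrite O1E => -[/delta_class_s1E[ex cx] /(_ _ (delta_class_refl _))].
rewrite !lenE (ell_sreflE i1) => Lx; split=> //.
by move: ex Lx; rewrite even_ell; case: (ell x) => [|[]].
Qed.

(** [t (m, 0)] attains the lower bound of [zabs_le_ell]. *)
Lemma min_length_Oeven m x : (0 < m)%N -> min_length (Oeven m) x ->
  [/\ even_fin x, zabs x = m & ell x = m.*2].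
Proof.
move=> m0; rewrite OevenE // => -[/delta_class_tE[ex zx] /(_ _ (delta_class_refl _))].
rewrite !lenE ell_t => Lx; split=> //.
by apply/eqP; rewrite eqn_leq -{2}zx zabs_le_ell // andbT (leq_trans Lx) //; lia.
Qed.

Lemma delta_delta x : delta (delta x) = x.
Proof. by case: x => [[a b] u]; rewrite /delta /= -conjgM tperm2 conjg1. Qed.

Lemma delta_inv_class x y : delta_class x y -> (x * delta x = 1)%g ->
  (y * delta y = 1)%g.
Proof.
case=> z -> x1; rewrite (deltaM (z * x)%g) (deltaM z) delta_inv delta_delta.
by rewrite !mulgA mulgKV -(mulgA z) x1 mulg1 mulgV.
Qed.

Lemma is_trace_class O : delta_classes O -> (forall x, O x -> (x * delta x = 1)%g) ->
  is_trace (fun x => `[< O x >]%:R).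
Proof.
move=> [a _ aO] O1.
have E x y : delta_class x y -> `[< O x >] = `[< O y >].
  move=> xy; apply/asbool_equiv_eq; rewrite -aO; split=> ax.
    exact: delta_class_trans ax xy.
  exact: delta_class_trans ax (delta_class_sym xy).
apply: is_trace_indic => [x /asboolP/O1//|i x|x]; last first.
  by apply/esym/E; exact: delta_class_twist.
apply: E; have := delta_class_srefl i (srefl i * x)%g.
by rewrite mulgA srefl2 mul1g.
Qed.

(** An odd [x] is central or lies in O_1. An even [x] lies in O_2m for [m = zabs x > 0], and is
    delta-conjugate to 1 if [zabs x = 0]. *)
Lemma class_cases O x : delta_classes O -> O x ->
  [\/ (x * delta x = 1)%g, O = O1 | exists2 m, (0 < m)%N & O = Oeven m].
Proof.
move=> OO Ox; have [ex|ex] := boolP (even_fin x); last first.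
  have [cx|cx] := boolP (central x); first by apply/Or31/central_inv.
  apply: Or32; apply: (class_eq OO O1_class Ox).
  by rewrite O1E; apply/delta_class_s1E.
have [z0|z0] := posnP (zabs x); last first.
  apply: Or33; exists (zabs x) => //; apply: (class_eq OO (Oeven_class z0) Ox).
  by rewrite OevenE //; apply/delta_class_tE.
have /delta_class_tE/delta_inv_class H : even_fin x /\ zabs x = 0%N by [].
by apply/Or31/H; rewrite delta_t ext_mulE Defs.act1 addr0 mulg1.
Qed.

Lemma sep_Oeven j m x : (0 < m)%N -> min_length (Oeven m) x ->
  sep j x = (m == j)%:R - (m == j.+2)%:R.
Proof.
move=> m0 /(min_length_Oeven m0)[ex zx Lx].
rewrite /sep ex zx Lx doubleK subrr mulr0 addr0 /rho0 rmorphB /=.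
by case: (m == j); case: (m == j.+2).
Qed.

Lemma sep_O1 j x : (0 < j)%N -> min_length O1 x -> sep j x = 0.
Proof.
move=> j0 /min_length_O1[ex cx Lx]; rewrite /sep (negbTE ex) (negbTE cx) Lx /cut.
by rewrite (_ : _ - _ = 0) ?mulr0 //; lia.
Qed.

(** * Linear independence of the minimal length elements *)

Section Uniqueness.

(** [g] stands for the difference of two coefficient families, [s] for a finite list containing its
    support, and [m] for a choice of minimal length elements. *)
Context (g : set ext_weyl -> laurent) (s : seq (set ext_weyl)).
Context (m : set ext_weyl -> ext_weyl).
Hypotheses (us : uniq s) (s_class : forall O, O \in s -> delta_classes O).
Hypothesis g0 : forall O, O \notin s -> g O = 0.
Hypothesis m_min : forall O, delta_classes O -> min_length O (m O).
Hypothesis g_trace : forall phi, is_trace phi -> \sum_(O <- s) g O * phi (m O) = 0.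

Lemma pick_sum O : \sum_(O' <- s) g O' * (O' == O)%:R = g O.
Proof.
have [Os|Os] := boolP (O \in s); last first.
  rewrite g0 // big1_seq // => O' /andP[_ O's].
  by case: eqVneq O's => [->|_ _]; rewrite ?(negbTE Os) // mulr0.
rewrite (bigD1_seq O) //= eqxx mulr1 big1 ?addr0 // => O' /negbTE->.
by rewrite mulr0.
Qed.

Lemma coef_inv O : delta_classes O -> (m O * delta (m O) = 1)%g -> g O = 0.
Proof.
move=> OO mO1; have [a _ aO] := OO.
have Oinv x : O x -> (x * delta x = 1)%g.
  move=> Ox; have [OmO _] := m_min OO; apply: delta_inv_class mO1.
  move: OmO Ox; rewrite -aO => /delta_class_sym; exact: delta_class_trans.
rewrite -[LHS]pick_sum -[RHS](g_trace (is_trace_class OO Oinv)).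
rewrite !big_seq; apply: eq_bigr => O' /s_class O'O; congr (_ * _%:R).
have [O'm _] := m_min O'O; congr nat_of_bool.
apply/eqP/asboolP => [<-//|Om]; exact: class_eq O'm Om.
Qed.

Lemma coef_even_step j : (0 < j)%N -> g (Oeven j) = g (Oeven j.+2).
Proof.
move=> j0; apply/eqP; rewrite -subr_eq0 -!pick_sum -sumrB.
rewrite -[X in _ == X](g_trace (is_trace_sep j0)); apply/eqP.
rewrite !big_seq; apply: eq_bigr => O /s_class OO; have Om := m_min OO.
rewrite -mulrBr.
have [/(coef_inv OO) ->|E|[n n0 E]] := class_cases OO Om.1; first by rewrite !mul0r.
  rewrite E in Om *; rewrite (sep_O1 j0 Om).
  have N k : (0 < k)%N -> (O1 == Oeven k) = false.
    by move=> k0; apply/eqP => /esym; exact: Oeven_neq_O1.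
  by rewrite !N // subrr.
rewrite E in Om *; rewrite (sep_Oeven j n0 Om); congr (_ * (_%:R - _%:R));
  congr nat_of_bool; apply/eqP/eqP => [|->//]; exact: Oeven_inj.
Qed.

Lemma coef_even j : (0 < j)%N -> g (Oeven j) = 0.
Proof.
move=> j0; apply/eqP; apply/negPn/negP => gj.
have gE n : g (Oeven (j + n.*2)) = g (Oeven j).
  elim: n => [|n IH]; first by rewrite addn0.
  by rewrite doubleS !addnS -coef_even_step // addn_gt0 j0.
(* These distinct classes all have the same nonzero coefficient, so they would lie in [s], which is
   shorter. *)
pose r := [seq Oeven (j + n.*2) | n <- iota 0 (size s).+1].
have : (size r <= size s)%N.
  apply: uniq_leq_size.
    rewrite map_inj_uniq ?iota_uniq // => a b /Oeven_inj E.
    by have := E _ _; rewrite !addn_gt0 j0 => /(_ isT isT); lia.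
  move=> O /mapP[n _ ->]; apply/negPn/negP => /g0 gn.
  by move: gj; rewrite -(gE n) gn eqxx.
by rewrite size_map size_iota ltnn.
Qed.

Lemma coef_O1 : g O1 = 0.
Proof.
have gv : g O1 * v = 0.
  rewrite -(pick_sum O1) mulr_suml -[RHS](g_trace is_trace_ell).
  rewrite !big_seq; apply: eq_bigr => O /s_class OO; have Om := m_min OO.
  rewrite -mulrA.
  have [/(coef_inv OO) ->|E|[n n0 E]] := class_cases OO Om.1; first by rewrite !mul0r.
    by rewrite E eqxx mul1r; rewrite E in Om; have [_ _ ->] := min_length_O1 Om.
  by rewrite E coef_even // !mul0r.
(* [v] is invertible. *)
by rewrite -[g O1]mulr1 -mulvV mulrA gv mul0r.
Qed.

Lemma coef_eq0 O : g O = 0.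
Proof.
have [/s_class OO|/g0//] := boolP (O \in s).
have [/(coef_inv OO)//|->|[n n0 ->]] := class_cases OO (m_min OO).1.
  exact: coef_O1.
exact: coef_even.
Qed.

End Uniqueness.

Lemma fsum_classes (V : lmodType laurent) (s : seq (set ext_weyl))
    (f : set ext_weyl -> laurent) (F : set ext_weyl -> V) :
  uniq s -> (forall O, O \in s -> delta_classes O) ->
  (forall O, O \notin s -> f O = 0) ->
  \sum_(O \in delta_classes) f O *: F O = \sum_(O <- s) f O *: F O.
Proof.
move=> us sO f0; rewrite [RHS]fsbig_seq //; apply/esym/fsbig_widen.
  by move=> O; exact: sO.
by move=> O [_ /= /negP /f0 ->]; rewrite scale0r.
Qed.

(** * Uniqueness of the class polynomials *)

Section ClassPoly.

Context (H : algType laurent) (T : ext_weyl -> H) (dH : {linear H -> H}).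
Hypotheses (hT : is_hecke T) (hdH : forall x, dH (T x) = T (delta x)).

Lemma class_poly_unique x f f' :
  is_class_poly T dH x f -> is_class_poly T dH x f' -> f = f'.
Proof.
move=> [/finite_seqP[r rf] fO fm] [/finite_seqP[r' rf'] f'O f'm].
(* A minimal length element of [O], with default value 1 if there is none. *)
pose m O := xget 1%g (min_length O).
have m_min O : delta_classes O -> min_length O (m O).
  by move=> /min_length_exists[y yO]; exact: (xgetPex 1%g (ex_intro _ y yO)).
pose s := undup (r ++ r').
have us : uniq s by exact: undup_uniq.
have memr O : (O \in r) = (f O != 0).
  by apply/idP/idP; have := congr1 (@^~ O) rf => /= ->.
have memr' O : (O \in r') = (f' O != 0).
  by apply/idP/idP; have := congr1 (@^~ O) rf' => /= ->.
have sO O : O \in s -> delta_classes O.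
  by rewrite mem_undup mem_cat memr memr' => /orP[/fO|/f'O].
have sf O : O \notin s -> f O = 0 /\ f' O = 0.
  rewrite mem_undup mem_cat memr memr' => /norP[/negPn/eqP fO0 /negPn/eqP f'O0].
  by [].
apply/funext => O; apply: subr0_eq.
apply: (@coef_eq0 (fun O => f O - f' O) s m us sO) => [{}O /sf[-> ->]|//|phi phi_trace].
  by rewrite subrr.
(* The trace is applied to the difference of the two expansions, in which [T x] cancels. *)
have := lift_cocomm hT hdH phi_trace (cocommD (cocommZ (-1) (fm m m_min)) (f'm m m_min)).
rewrite !(fsum_classes _ us sO) => [|{}O /sf[]//|{}O /sf[]//].
rewrite scaleN1r opprB addrA subrK -sumrB raddf_sum /= => {2}<-.
apply: eq_bigr => {}O _.
by rewrite -scalerBl liftZ liftT.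
Qed.

End ClassPoly.

(** * The explicit coefficients and the conclusion *)

Section ClassCoef.

Context (k : nat).

Definition coef_supp : seq (set ext_weyl) :=
  O1 :: [seq Oeven i.+1 | i <- iota 0 k].

Definition class_coef (O : set ext_weyl) : laurent :=
  if O == O1 then 1 else if O \in coef_supp then xi else 0.

Lemma coef_supp_class O : O \in coef_supp -> delta_classes O.
Proof.
rewrite inE => /orP[/eqP->|/mapP[i _ ->]]; first exact: O1_class.
exact: Oeven_class.
Qed.

Lemma Oeven_notin_O1 r : (O1 \in [seq Oeven i.+1 | i <- r]) = false.
Proof. by apply/negP => /mapP[i _ /esym]; exact: Oeven_neq_O1. Qed.

Lemma coef_supp_uniq : uniq coef_supp.
Proof.
rewrite /= Oeven_notin_O1 map_inj_uniq ?iota_uniq // => i j /Oeven_inj E.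
by have := E isT isT; case.
Qed.

Lemma class_coef0 O : O \notin coef_supp -> class_coef O = 0.
Proof.
rewrite /class_coef => Os; rewrite (negbTE Os); case: eqP => // OE.
by move: Os; rewrite OE mem_head.
Qed.

Lemma class_coef_O1 : class_coef O1 = 1. Proof. by rewrite /class_coef eqxx. Qed.

Lemma class_coef_Oeven i : (i < k)%N -> class_coef (Oeven i.+1) = xi.
Proof.
move=> ik; rewrite /class_coef ifN; last by apply/eqP; exact: Oeven_neq_O1.
rewrite ifT // inE; apply/orP; right; apply/mapP.
by exists i; rewrite ?mem_iota.
Qed.

Lemma is_class_poly_coef (H : algType laurent) (T : ext_weyl -> H)
    (dH : {linear H -> H})
    (hT : is_hecke T) (hdH : forall x, dH (T x) = T (delta x)) x :
  O1 x -> len x = k.*2.+1 -> is_class_poly T dH x class_coef.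
Proof.
move=> O1x; rewrite lenE => Lx.
have suppP : [set O | class_coef O != 0] `<=` [set` coef_supp].
  by move=> O /= fO; apply/negPn/negP => /class_coef0 E; move: fO; rewrite E eqxx.
split; first exact: sub_finite_set suppP (finite_seq _).
  by move=> O /suppP; exact: coef_supp_class.
move=> m m_min.
rewrite (fsum_classes _ coef_supp_uniq coef_supp_class class_coef0).
move: O1x; rewrite O1E => /delta_class_s1E[ex cx].
apply: eqc_trans (eqc_O1 hT hdH ex cx Lx) _.
rewrite /O1_sum /coef_supp big_cons big_map class_coef_O1 scale1r; apply: eqcD.
  (* The case [k = 0] of [eqc_O1] compares any minimal length element of O_1 with
     [Ext (1, 0) r1]. *)
  have [em cm Lm] := min_length_O1 (m_min _ O1_class).
  have /(_ 0%N) := eqc_O1 hT hdH em cm; rewrite /O1_sum big_geq // scaler0 addr0.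
  by move=> /(_ Lm); exact: eqc_sym.
rewrite scaler_sumr /index_iota subn0 !big_seq; apply: eqc_sum => i.
rewrite mem_iota => /= ik; rewrite class_coef_Oeven //; apply: eqcZ.
have [ei zi Li] := min_length_Oeven (ltn0Sn i) (m_min _ (Oeven_class (ltn0Sn i))).
by rewrite -[X in t (X%:Z, 0)]zi; apply/eqc_sym/(eqc_min_even hT hdH) => //; rewrite zi.
Qed.

End ClassCoef.

Theorem proposition2p44 (H : algType laurent) (T : ext_weyl -> H)
    (dH : {linear H -> H}) (hT : is_hecke T)
    (hdH : forall x : ext_weyl, dH (T x) = T (delta x))
    (w : ext_weyl) (k : nat) (hw : O1 w) (hk : len w = (2 * k + 1)%N) :
  [/\ forall j : nat, (1 <= j <= k)%N -> class_poly T dH w (Oeven j) = v - vV,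
      class_poly T dH w O1 = 1
    & forall O : set ext_weyl, delta_classes O ->
        (forall j : nat, (1 <= j <= k)%N -> O <> Oeven j) -> O <> O1 ->
        class_poly T dH w O = 0].
Proof.
have hk' : len w = k.*2.+1 by rewrite hk addn1 mul2n.
have F := is_class_poly_coef hT hdH hw hk'.
(* As a class polynomial exists, [xget] returns one, and uniqueness identifies it. *)
have -> : class_poly T dH w = class_coef k.
  by apply: (class_poly_unique hT hdH (xgetPex _ (ex_intro _ _ F)) F).
split=> [[//|j] /andP[_ jk]||O _ Oj ON]; first exact: class_coef_Oeven.
  exact: class_coef_O1.
apply: class_coef0; rewrite inE negb_or; apply/andP; split; first exact/eqP.
apply/negP => /mapP[i]; rewrite mem_iota => /andP[_ ik]; exact: Oj.
Qed.
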